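(* Let $k\ge 2$. For $\tau\in[0,r]$ we have the identity in distribution $$\sigma_k(kr-\tau)\stackrel{d}{\simeq}\int_0^\tau\int_0^{s_{k-1}^-}\cdots\int_0^{s_2^-}dN^{(1)}_{s_1}\cdots dN^{(k-1)}_{s_{k-1}},$$ where $(N^{(l)}_s)_{s\in[0,\infty)}$, $l=1,\ldots,k-1$, is a family of independent Poisson processes with respective intensities $\lambda_l(ds)=\lambda_l(s)ds$, $l=1,\ldots,k-1$.
   Context: Let $r>0$ be the connection radius of the one-dimensional unit disk random graph. Nodes are distributed on $[0,kr]$ according to a Poisson point process with intensity $\lambda(ds)=\sum_{l=1}^k\mathbf 1_{((l-1)r,lr]}(s)\,\lambda_l((l-1)r+ds)$, where $\lambda_l(ds)=\lambda_l(s)ds$, $l=1,\ldots,k$, are absolutely continuous intensity measures on $[0,r]$; that is, the intensity on the cell $((l-1)r,lr]$ is $\lambda_l$ with coordinate measured from the left endpoint $(l-1)r$. Additional nodes are located at $0$ and at $t\in[0,kr]$. Two nodes $s,t$ are connected if and only if $|t-s|\le r$. $\sigma_k(t)$ denotes the count of $k$-hops between the nodes at $0$ and $t$, a $k$-hop being a path made of $k$ edges that links $0$ to $t$ through $k-1$ nodes of the Poisson process. The symbol $\stackrel{d}{\simeq}$ denotes equality in distribution, and $s^-$ in an upper limit denotes the left limit at $s$.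
   Formalization: The Poisson process N^(l) is given intensity λ_l(r−s)ds on [0,r] instead of λ_l(s)ds; as stated the identity fails, e.g. for k=2, λ_1=1_[0,r/2], τ=r/2 (means 0 and r/2), and both versions agree when each λ_l is symmetric on [0,r]. *)

(* Defs.v *)
From HB Require Import structures.
From mathcomp Require Import all_boot all_order all_algebra.
From mathcomp Require Import finmap.
From mathcomp Require Import all_classical all_reals all_analysis.
From mathcomp Require Import measurable_realfun.

Set Implicit Arguments.
Unset Strict Implicit.
Unset Printing Implicit Defensive.
Import Order.TTheory GRing.Theory Num.Theory.
Import numFieldNormedType.Exports.
Local Open Scope classical_set_scope.
Local Open Scope ring_scope.

Section Probability.
Context {d : measure_display} {Omega : measurableType d} {R : realType}.
Variable P : probability Omega R.

(* Mutual independence of a finite family of classes of events. *)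
Definition mutually_independent (I : finType) (F : I -> set (set Omega)) :=
  forall (J : {set I}) (E : I -> set Omega),
    (forall i, i \in J -> F i (E i)) ->
    P (\bigcap_(i in [set` J]) E i) = (\prod_(i in J) P (E i))%E.

Definition sigma_of d' (T : measurableType d') (X : Omega -> T) :
    set (set Omega) :=
  preimage_set_system setT X measurable.

Definition count (X : Omega -> set R) (B : set R) (w : Omega) : nat :=
  #|` fset_set (X w `&` B)|.

(* A Poisson point process on a bounded set E with a finite diffuse intensity
   measure Lam is almost surely simple, so it is represented by the random
   finite set of its points.  The second argument of poisson_prob is a dummy;
   poisson_prob is used rather than poisson_pmf because the latter is not the
   Dirac mass at 0 when the rate is 0. *)
Definition poisson_point_process (E : set R) (X : Omega -> set R)
    (Lam : set R -> \bar R) :=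
  [/\ forall w, finite_set (X w) /\ X w `<=` E,
      forall B : set R, measurable B -> measurable_fun setT (count X B),
      forall (B : set R) (n : nat), measurable B ->
        P [set w | count X B w = n] = poisson_prob (fine (Lam B)) 0%N [set n] &
      forall (n : nat) (B : 'I_n -> set R),
        (forall i, measurable (B i)) -> trivIset setT B ->
        mutually_independent (fun i => sigma_of (count X (B i)))].

(* Time runs over [0, +oo[: nothing is required of, and nothing below depends
   on, the values of the paths at negative times, which are only there because
   elements of `cumulative R R` are functions on the whole line. *)
Definition poisson_process (N : Omega -> cumulative R R)
    (Lam : set R -> \bar R) :=
  [/\ forall w, N w 0 = 0,
      forall w (t : R), 0 <= t -> exists n : nat, N w t = n%:R,
      forall t : R, 0 <= t -> measurable_fun setT (fun w => N w t : R),
      forall (s t : R) (n : nat), 0 <= s -> s <= t ->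
        P [set w | N w t - N w s = n%:R] =
        poisson_prob (fine (Lam `]s, t]%classic)) 0%N [set n] &
      forall (n : nat) (t : nat -> R), 0 <= t 0%N -> nondecreasing_seq t ->
        mutually_independent
          (fun i : 'I_n => sigma_of (fun w => N w (t i.+1) - N w (t i) : R))].

Definition sigma_of_process (N : Omega -> cumulative R R) :
    set (set Omega) :=
  <<s \bigcup_(t in [set t : R | 0 <= t]) sigma_of (fun w => N w t : R) >>.

End Probability.

Definition eq_in_distribution (R : realType) (d1 d2 d : measure_display)
    (O1 : measurableType d1) (O2 : measurableType d2) (T : measurableType d)
    (P1 : probability O1 R) (P2 : probability O2 R)
    (X : O1 -> T) (Y : O2 -> T) :=
  [/\ measurable_fun setT X, measurable_fun setT Y &
      forall A : set T, measurable A ->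
        pushforward P1 X A = pushforward P2 Y A].

Section UnitDisk.
Context {R : realType}.

Definition connected_nodes (r : R) : rel R := fun s t => `|t - s| <= r.

(* The successive intermediate nodes of the k-hops from 0 to t. *)
Definition khops (r : R) (X : set R) (k : nat) (t : R) : set (k.-1.-tuple R) :=
  [set x | [/\ uniq x, forall y, y \in x -> X y &
               path (connected_nodes r) 0 (rcons x t)]].
Arguments khops r X k t : clear implicits.

Definition khop_count (r : R) (X : set R) (k : nat) (t : R) : \bar R :=
  counting (khops r X k t).

(* The density on cell l = ](l-1)r, lr] is lam l, in the coordinate measured
   from the left endpoint (l-1)r of the cell. *)
Definition node_density (r : R) (k : nat) (lam : nat -> R -> R) (x : R) : R :=
  \sum_(1 <= l < k.+1)
    \1_(`](l.-1%:R * r), (l%:R * r)] : set R) x * lam l (x - l.-1%:R * r).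

Definition node_intensity (r : R) (k : nat) (lam : nat -> R -> R)
    (B : set R) : \bar R :=
  \int[lebesgue_measure]_(x in B) (node_density r k lam x)%:E.

(* The measure with density s |-> lam (r - s) on [0, r], zero outside [0, r]:
   the image of lam(s)ds under the reflection s |-> r - s.  The l-th node of a
   k-hop to k r - tau is l r - s_l with 0 <= s_1 <= ... <= s_(k-1) <= tau, so
   the time s of the l-th Poisson process runs backwards from the right
   endpoint of cell l, while the coordinate in node_density runs forwards from
   its left endpoint. *)
Definition reflected_intensity (r : R) (lam : R -> R) (B : set R) : \bar R :=
  \int[lebesgue_measure]_(s in B `&` `[0, r]) (lam (r - s))%:E.

(* iterated_integral dN m s is the pathwise m-fold Lebesgue-Stieltjes integral
   of 1 over 0 < s_1 < ... < s_m < s with respect to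
   dN 1 (ds_1) ... dN m (ds_m): the upper limits s^- exclude s. *)
Fixpoint iterated_integral (dN : nat -> cumulative R R) (m : nat) (s : R) :
    \bar R :=
  if m is m'.+1 then
    \int[lebesgue_stieltjes_measure (dN m)]_(u in `]0, s[)
      iterated_integral dN m' u
  else 1%E.

(* Same with m.+1 integrals and the closed outer upper limit tau. *)
Definition iterated_integral_closed (dN : nat -> cumulative R R) (m : nat)
    (tau : R) : \bar R :=
  \int[lebesgue_stieltjes_measure (dN m.+1)]_(u in `]0, tau])
    iterated_integral dN m u.

End UnitDisk.

(* Main.v *)
(* Write the l-th node of a k-hop to k r - tau as x_l = l r - s_l.  Up to ties
   and cell end points, which are null events, the k-hop condition becomes
   0 < s_1 < ... < s_(k-1) <= tau, so both sides count the increasing words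
   s_1 < ... < s_(k-1) whose l-th letter is a point of an l-th finite point
   set: the reflected nodes of cell l on one side, the jump times of N^(l) on
   the other.  Replacing positions by cells of length 1/(n+1) turns this number
   into one fixed polynomial in the numbers of points per cell; these are
   independent Poisson variables with the same rates on both sides, so the
   discretised numbers have the same law.  For each realisation the
   discretised number is eventually equal to the true one, which gives
   measurability and, by dominated convergence, equality of the laws. *)
Require Import Defs.
From HB Require Import structures.
From mathcomp Require Import all_boot all_order all_algebra.
From mathcomp Require Import finmap.
From mathcomp Require Import all_classical all_reals all_analysis.
From mathcomp Require Import measurable_realfun.
From mathcomp Require Import lra.
Import Order.TTheory GRing.Theory Num.Theory.
Import numFieldNormedType.Exports.
Local Open Scope classical_set_scope.
Local Open Scope ring_scope.

Set Implicit Arguments.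
Unset Strict Implicit.
Unset Printing Implicit Defensive.

(** The hypotheses describe a Poisson set only through its counts on disjoint sets, and a process
    only through its increments, so the two laws have to be compared through finitely many counts;
    hence the grid. Stabilisation on the grid holds for every realisation, with a threshold
    depending on it, so the limit costs no null set. Null sets enter elsewhere: a hop of length
    exactly [r] is allowed and means equal reflected times, whereas the integral asks for strict
    inequalities; likewise a node at the right end of a cell is reflected to time 0, which the
    integral leaves out. Points at exact distance [r] in consecutive cells are excluded by
    independence: on a grid their probability is at most the largest cell mass on one side times the
    total mass on the other, and absolute continuity sends this to 0. Since [P] need not be
    complete, almost sure equality says nothing on measurability; the number of k-hops therefore
    gets a second discretisation, on the whole of [0, kr] and with the hop relation itself, for
    measurability alone. *)

(** * Words over position-dependent alphabets *)

Section Words.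
Variable T : Type.
Implicit Types (P : nat -> seq T) (G : pred (seq T)).

(* Letters are indexed from 1: the l-th letter of a word comes from [P l]. *)
Fixpoint words P m : seq (seq T) :=
  if m is m'.+1 then [seq rcons h y | y <- P m, h <- words P m'] else [:: [::]].

Lemma count_wordsS P m G :
  count G (words P m.+1) =
  (\sum_(y <- P m.+1) count (fun h => G (rcons h y)) (words P m))%N.
Proof.
rewrite /= count_flatten -map_comp sumnE big_map; apply: eq_bigr => y _ /=.
by rewrite count_map.
Qed.

End Words.

Lemma mem_words (T : eqType) (P : nat -> seq T) m h : h \in words P m ->
  size h = m /\ forall x0 i, (i < m)%N -> nth x0 h i \in P i.+1.
Proof.
elim: m h => [|m ih] h /=; first by rewrite inE => /eqP ->.
case/allpairsP => -[y h'] /= [yP /ih[sz hP] ->]; split.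
  by rewrite size_rcons sz.
move=> x0 i; rewrite ltnS leq_eqVlt => /orP[/eqP ->|im].
  by rewrite nth_rcons sz ltnn eqxx.
by rewrite nth_rcons sz im; exact: hP.
Qed.

Lemma words_const_uniq (T : eqType) (s : seq T) m : uniq s ->
  uniq (words (fun=> s) m).
Proof.
move=> us; elim: m => //= m ih; apply: allpairs_uniq => //.
by move=> [y h] [y' h'] _ _ /= /rcons_inj[-> ->].
Qed.

Lemma mem_words_const (T : eqType) (s : seq T) m h :
  (h \in words (fun=> s) m) = (size h == m) && all (mem s) h.
Proof.
elim: m h => [|m ih] h /=; first by rewrite inE; case: h.
apply/allpairsP/andP => [[[y h'] /= [ys]]|].
  rewrite ih => /andP[/eqP sz hs] ->; rewrite size_rcons sz eqxx.
  by rewrite all_rcons hs andbT.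
case; case/lastP: h => // h y; rewrite size_rcons all_rcons eqSS => sz /andP[ys hs].
by exists (y, h); rewrite /= ih sz hs.
Qed.

Section WordsMap.
Variables (T : eqType) (T' : Type).

Lemma words_map (f : T -> T') (P : nat -> seq T) m :
  words (fun l => map f (P l)) m = map (map f) (words P m).
Proof.
elim: m => //= m ->; elim: (P m.+1) => //= y s ->.
rewrite map_cat -!map_comp; congr (_ ++ _); apply: eq_map => h /=.
by rewrite map_rcons.
Qed.

(** [l] is the number of letters already read, so the first letter receives [phi l.+1]. The map
    depends on the position because the [l]-th node is reflected about its own end point [l r]. *)
Fixpoint walkmap (phi : nat -> T -> T') l (h : seq T) : seq T' :=
  if h is x :: h' then phi l.+1 x :: walkmap phi l.+1 h' else [::].

Lemma walkmap_rcons phi l h y :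
  walkmap phi l (rcons h y) = rcons (walkmap phi l h) (phi (l + size h).+1 y).
Proof.
elim: h l => [|x h ih] l /=; first by rewrite addn0.
by rewrite ih addnS addSn.
Qed.

Fixpoint walkall (B : nat -> pred T) l (h : seq T) : bool :=
  if h is x :: h' then B l.+1 x && walkall B l.+1 h' else true.

Lemma walkall_rcons B l h y :
  walkall B l (rcons h y) = walkall B l h && B (l + size h).+1 y.
Proof.
elim: h l => [|x h ih] l /=; first by rewrite addn0 andbT.
by rewrite ih addnS addSn andbA.
Qed.

(** Bridges two alphabets: the nodes of a k-hop all come from one set, whereas the increasing words
    take their [l]-th letter from the nodes of cell [l]. A letter rejected by [B] contributes no
    word on either side. *)
Lemma count_words_map_filter (phi : nat -> T -> T') (B : nat -> pred T)
    (P : nat -> seq T) m (G : pred (seq T')) :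
  count G (words (fun l => [seq phi l x | x <- P l & B l x]) m) =
  count (fun h => walkall B 0 h && G (walkmap phi 0 h)) (words P m).
Proof.
elim: m G => [|m ih] G; first by [].
rewrite !count_wordsS big_map big_filter [RHS](bigID (B m.+1)) /=.
rewrite [X in (_ + X)%N]big1 ?addn0 => [|y /negbTE By].
  apply: eq_bigr => y By; rewrite ih; apply: eq_in_count => h /mem_words[sz _].
  by rewrite walkall_rcons walkmap_rcons add0n sz By andbT.
apply/eqP; rewrite eqn0Ngt -has_count -all_predC; apply/allP => h.
by move=> /mem_words[sz _] /=; rewrite walkall_rcons add0n sz By andbF.
Qed.

End WordsMap.

(** * Word counts as polynomials in letter multiplicities, and their stabilisation *)

Section Discretisation.

(** Expanded, this is the sum of the products [c 1 j_1 * ... * c m j_m] over the index words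
    [j_1 ... j_m] with letters below [K] that [g] accepts. *)
Fixpoint word_poly K (c : nat -> nat -> nat) (g : pred (seq nat)) m : nat :=
  if m is m'.+1 then
    (\sum_(j < K) c m j * word_poly K c (fun h => g (rcons h j)) m')%N
  else g [::].

Lemma eq_word_poly K c c' g m :
  (forall l j, (0 < l <= m)%N -> (j < K)%N -> c l j = c' l j) ->
  word_poly K c g m = word_poly K c' g m.
Proof.
elim: m g => //= m ih g cc'; apply: eq_bigr => j _.
rewrite cc' ?leqnn// (ih (fun h => g (rcons h j)))// => l i /andP[l0 lm].
by apply: cc'; rewrite l0 ltnW.
Qed.

(** An index word is spelled as many times as the product of the multiplicities of its letters, so
    the positions disappear and only counts per cell are left. *)
Lemma count_words_poly K (P : nat -> seq nat) g m :
  (forall l, (0 < l <= m)%N -> all (fun j => j < K)%N (P l)) ->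
  count g (words P m) = word_poly K (fun l j => count_mem j (P l)) g m.
Proof.
elim: m g => [|m ih] g PK; first by rewrite /= addn0.
rewrite count_wordsS.
rewrite (eq_bigr (fun y => word_poly K (fun l j => count_mem j (P l))
    (fun h => g (rcons h y)) m)); last first.
  by move=> y _; rewrite ih// => l /andP[l0 lm]; rewrite PK// l0 ltnW.
have := PK m.+1; rewrite leqnn => /(_ isT).
rewrite [RHS]/=; elim: (P m.+1) => [|y s ihs] /=.
  by rewrite big_nil big1// => j _.
move=> /andP[yK sK]; rewrite big_cons (ihs sK).
under [RHS]eq_bigr do rewrite mulnDl.
rewrite big_split /=; congr (_ + _)%N.
rewrite (bigD1 (Ordinal yK))//= eqxx mul1n big1 ?addn0// => i /negbTE iy.
case: eqP => [yi|]; rewrite ?mul0n//; move: iy; rewrite -val_eqE/= yi.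
by rewrite eqxx.
Qed.

Lemma eventually_all (T : eqType) (s : seq T) (p : nat -> pred T) :
  (forall x, x \in s -> exists M, forall n, (M <= n)%N -> p n x) ->
  exists M, forall n, (M <= n)%N -> all (p n) s.
Proof.
elim: s => [|x s ih] h; first by exists 0%N.
have [M1 h1] := h x (mem_head x s).
have [|M2 h2] := ih; first by move=> y ys; apply: h; rewrite inE ys orbT.
exists (maxn M1 M2) => n; rewrite geq_max => /andP[n1 n2] /=.
by rewrite h1// h2.
Qed.

(** There are finitely many words, so thresholds found word by word have a common bound. *)
Lemma count_words_stable (T : eqType) (P : nat -> seq T) m (G : pred (seq T))
    (f : nat -> T -> nat) (g : nat -> pred (seq nat)) :
  (forall h, h \in words P m ->
    exists M, forall n, (M <= n)%N -> g n (map (f n) h) = G h) ->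
  exists M, forall n, (M <= n)%N ->
    count (g n) (words (fun l => map (f n) (P l)) m) = count G (words P m).
Proof.
move=> fg.
have [|M hM] := @eventually_all _ (words P m)
   (fun n h => g n (map (f n) h) == G h).
  by move=> h /fg[M hM]; exists M => n /hM/eqP.
exists M => n /hM /allP h; rewrite words_map count_map.
by apply: eq_in_count => x /h/eqP.
Qed.

Lemma path_stable (T : eqType) (e : rel T) (f : nat -> T -> nat)
    (e' : nat -> rel nat) x s :
  (forall y z, y \in x :: s -> z \in s ->
     exists M, forall n, (M <= n)%N -> e' n (f n y) (f n z) = e y z) ->
  exists M, forall n, (M <= n)%N ->
    path (e' n) (f n x) (map (f n) s) = path e x s.
Proof.
elim: s x => [|y s ih] x h; first by exists 0%N.
have [M1 h1] := h x y (mem_head _ _) (mem_head _ _).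
have [|M2 h2] := ih y.
  by move=> u v us vs; apply: h; rewrite inE ?us ?vs orbT.
exists (maxn M1 M2) => n; rewrite geq_max => /andP[n1 n2] /=.
by rewrite h1// h2.
Qed.

End Discretisation.

Lemma uniq_map_stable (T : eqType) (T' : eqType) (f : nat -> T -> T') s :
  (forall x y, x \in s -> y \in s ->
    exists M, forall n, (M <= n)%N -> (f n x == f n y) = (x == y)) ->
  exists M, forall n, (M <= n)%N -> uniq (map (f n) s) = uniq s.
Proof.
move=> fs.
have [|M hM] := @eventually_all _ (allpairs pair s s)
  (fun n p => (f n p.1 == f n p.2) == (p.1 == p.2)).
  move=> [x y] /allpairsP[[u v] [us vs [-> ->]]].
  by have [M h] := fs _ _ us vs; exists M => n /h ->.
exists M => n /hM /allP h; have [us|nus] := boolP (uniq s).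
  rewrite map_inj_in_uniq// => x y xs ys /eqP fxy.
  by apply/eqP; rewrite -(eqP (h (x, y) _))//; apply/allpairsP; exists (x, y).
by apply: contraNF nus; exact: map_uniq.
Qed.

(** * Rounding positions to a grid *)

Section Cells.
Context {R : realType}.
Implicit Types (x y r : R) (n : nat).

(* For [x >= 0], the index [j] of the cell ](j-1)/(n+1), j/(n+1)] holding [x]. *)
Definition cell n x : nat := `|Num.ceil (x * n.+1%:R)|%N.

Lemma cell_itv n x : 0 <= x ->
  (cell n x)%:R - 1 < x * n.+1%:R <= (cell n x)%:R.
Proof.
move=> x0; have := ceil_itv (x * n.+1%:R).
have : 0 <= Num.ceil (x * n.+1%:R).
  by rewrite ceil_ge0 (@lt_le_trans _ _ 0)// ?ltrN10// mulr_ge0.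
rewrite /cell; case: (Num.ceil _) => // m _.
by rewrite intrD.
Qed.

Lemma cell_eq n x j : 0 <= x ->
  (cell n x == j) = (j%:R - 1 < x * n.+1%:R <= j%:R).
Proof.
move=> x0; have /andP[h1 h2] := cell_itv n x0; apply/eqP/idP => [<-|/andP[h3 h4]].
  by rewrite h1.
apply/eqP; rewrite eqn_leq -[(_ <= j)%N]ltnS -[(j <= _)%N]ltnS.
rewrite -!(ltr_nat R) -(natr1 j) -(natr1 (cell n x)).
by apply/andP; split; lra.
Qed.

Lemma le_cell n x y : 0 <= x -> x <= y -> (cell n x <= cell n y)%N.
Proof.
move=> x0 xy; have /andP[h1 _] := cell_itv n x0.
have /andP[_ h2] := cell_itv n (le_trans x0 xy).
have h3 : x * n.+1%:R <= y * n.+1%:R by rewrite ler_wpM2r.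
rewrite -ltnS -(ltr_nat R) -(natr1 (cell n y)); lra.
Qed.

Lemma eventually_mul_ge (e c : R) : 0 < e ->
  exists M, forall n, (M <= n)%N -> c <= e * n.+1%:R.
Proof.
move=> e0; exists (Num.bound (`|c| / e)) => n nM.
rewrite mulrC -ler_pdivrMr//; apply: le_trans (_ : `|c| / e <= _).
  by rewrite ler_pM2r ?invr_gt0// ler_norm.
apply/ltW/(lt_le_trans (archi_boundP _)); first by rewrite divr_ge0// ltW.
by rewrite ler_nat ltnW.
Qed.

Lemma cell_lt x y : 0 <= x -> x < y ->
  exists M, forall n, (M <= n)%N -> (cell n x < cell n y)%N.
Proof.
(* Once the scaled gap is at least 1, rounding up cannot put the two points in one cell. *)
move=> x0 xy; have [|M hM] := @eventually_mul_ge (y - x) 1; first lra.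
exists M => n /hM h; have /andP[h1 _] := cell_itv n x0.
have /andP[_ h2] := cell_itv n (le_trans x0 (ltW xy)).
by rewrite -(ltr_nat R); nra.
Qed.

Lemma cell_lt_stable x y : 0 <= x -> 0 <= y ->
  exists M, forall n, (M <= n)%N -> (cell n x < cell n y)%N = (x < y).
Proof.
move=> x0 y0; case: (ltP x y) => [xy|yx].
  by have [M h] := cell_lt x0 xy; exists M => n /h.
by exists 0%N => n _; rewrite ltnNge le_cell.
Qed.

Lemma cell_eq_stable x y : 0 <= x -> 0 <= y ->
  exists M, forall n, (M <= n)%N -> (cell n x == cell n y) = (x == y).
Proof.
move=> x0 y0; case: (ltgtP x y) => [xy|xy|->].
- by have [M h] := cell_lt x0 xy; exists M => n /h; case: ltngtP.
- by have [M h] := cell_lt y0 xy; exists M => n /h; case: ltngtP.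
- by exists 0%N => n _; rewrite eqxx.
Qed.

(** Rounding both end points up changes their scaled distance by less than 1; the slack 1 keeps hops
    of length exactly [r]. *)
Definition connected_cells r n : rel nat := fun i j =>
  `|j%:R - i%:R| <= r * n.+1%:R + 1 :> R.

Lemma connected_cells_stable r x y : 0 <= x -> 0 <= y ->
  exists M, forall n, (M <= n)%N ->
    connected_cells r n (cell n x) (cell n y) = connected_nodes r x y.
Proof.
move=> x0 y0; rewrite /connected_cells /connected_nodes.
case: (leP `|y - x| r) => [|yxr].
  rewrite ler_norml => /andP[h1 h2]; exists 0%N => n _.
  have /andP[hx1 hx2] := cell_itv n x0; have /andP[hy1 hy2] := cell_itv n y0.
  have n0 : 0 <= n.+1%:R :> R by [].
  by rewrite ler_norml; apply/andP; split; nra.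
(* The 2 pays for the slack 1 of [connected_cells] and for the rounding error. *)
have [|M hM] := @eventually_mul_ge (`|y - x| - r) 2; first lra.
exists M => n /hM h.
have /andP[hx1 hx2] := cell_itv n x0; have /andP[hy1 hy2] := cell_itv n y0.
apply/negbTE; apply/negP; rewrite ler_norml => /andP[h1 h2].
move: h; rewrite mulrBl; case: (ger0P (y - x)) => _; rewrite ?mulNr mulrBl; lra.
Qed.

Lemma khop_words_stable r t (s : seq R) m : 0 <= t -> all (fun x => 0 <= x) s ->
  exists M, forall n, (M <= n)%N ->
    count (fun h => uniq h && path (connected_cells r n) (cell n 0)
                                    (rcons h (cell n t)))
          (words (fun=> map (cell n) s) m) =
    count (fun h => uniq h && path (connected_nodes r) 0 (rcons h t))
          (words (fun=> s) m).
Proof.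
move=> t0 /allP s0; apply: count_words_stable => h.
rewrite mem_words_const => /andP[_ /allP hs].
have h0 x : x \in h -> 0 <= x by move=> /hs/s0.
have [|M1 h1] := @uniq_map_stable R nat cell h.
  by move=> x y xh yh; apply: cell_eq_stable; exact: h0.
have [|M2 h2] := @path_stable R (connected_nodes r) cell (connected_cells r) 0 (rcons h t).
  move=> x y; rewrite inE !mem_rcons !inE => xh yh.
  apply: connected_cells_stable.
    by case/or3P: xh => [/eqP ->|/eqP ->|/h0].
  by case/orP: yh => [/eqP ->|/h0].
exists (maxn M1 M2) => n; rewrite geq_max => /andP[n1 n2].
by rewrite h1// -map_rcons h2.
Qed.

Lemma sorted_words_stable (P : nat -> seq R) m :
  (forall l, (0 < l <= m)%N -> all (fun x => 0 <= x) (P l)) ->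
  exists M, forall n, (M <= n)%N ->
    count (sorted ltn) (words (fun l => map (cell n) (P l)) m) =
    count (sorted <%R) (words P m).
Proof.
move=> P0; apply: (@count_words_stable _ _ _ _ cell (fun=> sorted ltn)) => h.
move=> /mem_words[sz hP].
have h0 x : x \in h -> 0 <= x.
  move=> /(nthP 0)[i]; rewrite sz => im <-.
  by have /P0/allP : (0 < i.+1 <= m)%N by []; apply; exact: hP.
case: h h0 {sz hP} => [|x h] h0; first by exists 0%N.
apply: (@path_stable _ <%R cell (fun=> ltn)) => y z yh zh.
by apply: cell_lt_stable; apply: h0; rewrite ?inE// zh orbT.
Qed.

End Cells.

(** * Laws of countably valued maps and their limits *)

Section DiscreteLaws.
Context {R : realType}.

Section Measurability.
Context {d} {Omega : measurableType d} {T : countType}.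

(** Values of [T] are numbered by [choice.pickle], so that a preimage is a disjoint union of fibres
    indexed by [nat]; codes without a value give the empty set. [T] will be [nat] or a type of
    finite vectors of counts. *)
Let piece (Z : Omega -> T) (A : set T) (n : nat) : set Omega :=
  if pickle_inv n is Some v then if v \in A then Z @^-1` [set v] else set0
  else set0.

Let preimage_piece (Z : Omega -> T) (A : set T) :
  Z @^-1` A = \bigcup_n piece Z A n.
Proof.
apply/seteqP; split => w /=.
  by move=> ZA; exists (choice.pickle (Z w)) => //; rewrite /piece pickleK_inv mem_set.
move=> [n _]; rewrite /piece; case: pickle_inv => //= v.
by case: ifPn => // /set_mem vA /= ->.
Qed.

Let trivIset_piece (Z : Omega -> T) (A : set T) : trivIset setT (piece Z A).
Proof.
apply/trivIsetP => i j _ _ ij; rewrite -subset0 => w []; rewrite /piece.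
case Ei: (pickle_inv i) => [v|]//; case: ifPn => // _ /= Zv.
case Ej: (pickle_inv j) => [u|]//; case: ifPn => // _ /= Zu.
move: ij; have := @pickle_invK T i; have := @pickle_invK T j.
by rewrite Ei Ej /= -Zv -Zu => -> ->; rewrite eqxx.
Qed.

Let measurable_piece (Z : Omega -> T) (A : set T) n :
  (forall v, measurable (Z @^-1` [set v])) -> measurable (piece Z A n).
Proof.
by move=> mZ; rewrite /piece; case: pickle_inv => // v; case: ifP.
Qed.

Lemma measurable_countable_preimage (Z : Omega -> T) (A : set T) :
  (forall v, measurable (Z @^-1` [set v])) -> measurable (Z @^-1` A).
Proof.
move=> mZ; rewrite preimage_piece; apply: bigcupT_measurable => n.
exact: measurable_piece.
Qed.

Lemma countable_preimage_series (P : probability Omega R) (Z : Omega -> T)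
    (A : set T) : (forall v, measurable (Z @^-1` [set v])) ->
  P (Z @^-1` A) = (\sum_(n <oo) if pickle_inv n is Some v then
     if v \in A then P (Z @^-1` [set v]) else 0 else 0)%E.
Proof.
move=> mZ; rewrite preimage_piece measure_bigcup//=; last first.
  by move=> n _; exact: measurable_piece.
rewrite (@eq_eseriesl _ _ predT) => [|n]; last by rewrite in_setT.
apply: eq_eseriesr => n _; rewrite /piece.
by case: pickle_inv => [v|]; [case: ifP|]; rewrite ?measure0.
Qed.

End Measurability.

Lemma countable_law_eq d1 d2 (O1 : measurableType d1) (O2 : measurableType d2)
    (T : countType) (P1 : probability O1 R) (P2 : probability O2 R)
    (Z1 : O1 -> T) (Z2 : O2 -> T) :
  (forall v, measurable (Z1 @^-1` [set v])) ->
  (forall v, measurable (Z2 @^-1` [set v])) ->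
  (forall v, P1 (Z1 @^-1` [set v]) = P2 (Z2 @^-1` [set v])) ->
  forall A, P1 (Z1 @^-1` A) = P2 (Z2 @^-1` A).
Proof.
move=> m1 m2 P12 A; rewrite !countable_preimage_series//.
by apply: eq_eseriesr => n _; case: pickle_inv => // v; rewrite P12.
Qed.

(** Eventual equality at every point makes the preimage of [A] under [u] the lower limit of its
    preimages under the [u_ n]. *)
Lemma measurable_eventually_eq d (O : measurableType d) (T : Type)
    (u_ : nat -> O -> T) (u : O -> T) (A : set T) :
  (forall n, measurable (u_ n @^-1` A)) ->
  (forall w, exists M, forall n, (M <= n)%N -> u_ n w = u w) ->
  measurable (u @^-1` A).
Proof.
move=> mu_ uu; rewrite (_ : _ @^-1` _ =
    \bigcup_M \bigcap_(n in [set n | (M <= n)%N]) (u_ n @^-1` A)); last first.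
  apply/seteqP; split => w /=.
    have [M h] := uu w; move=> uA; exists M => // n /= Mn.
    by rewrite /preimage/= h.
  move=> [N _ h]; have [M h'] := uu w.
  by rewrite -(h' (maxn M N)) ?leq_maxl//; apply: h => /=; rewrite leq_maxr.
apply: bigcupT_measurable => M; apply: bigcap_measurable => //.
by exists M => /=.
Qed.

Lemma probability_eventually_eq d (O : measurableType d) (T : Type)
    (P : probability O R) (u_ : nat -> O -> T) (u : O -> T) (A : set T) :
  (forall n, measurable (u_ n @^-1` A)) ->
  (forall w, exists M, forall n, (M <= n)%N -> u_ n w = u w) ->
  P (u_ n @^-1` A) @[n --> \oo] --> P (u @^-1` A).
Proof.
move=> mu_ uu; have mu := measurable_eventually_eq mu_ uu.
have ind B : measurable B -> P B = (\int[P]_w (\1_B w)%:E)%E.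
  by move=> mB; rewrite integral_indic// setIT.
rewrite ind//; under eq_cvg do rewrite ind//.
have [] // := @dominated_convergence _ _ _ P setT measurableT
  (fun n w => (\1_(u_ n @^-1` A) w)%:E) (fun w => (\1_(u @^-1` A) w)%:E)
  (cst 1%E).
- by move=> n; apply/measurable_EFinP; exact: measurable_indic.
- by apply/measurable_EFinP; exact: measurable_indic.
- apply: aeW => /= w _; have [M h] := uu w.
  apply: cvg_near_cst; exists M => // n /= Mn.
  rewrite !indicE; congr ((_ : bool)%:R%:E); have e := h n Mn.
  by apply/idP/idP; rewrite !inE /preimage/= e.
- exact: finite_measure_integrable_cst.
- by apply: aeW => w n _ /=; rewrite lee_fin indicE; case: (_ \in _); rewrite ?normr1 ?normr0.
Qed.

Lemma eventual_law_eq d1 d2 (O1 : measurableType d1) (O2 : measurableType d2)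
    (T : countType) (P1 : probability O1 R) (P2 : probability O2 R)
    (u_ : nat -> O1 -> T) (u : O1 -> T) (v_ : nat -> O2 -> T) (v : O2 -> T) :
  (forall n a, measurable (u_ n @^-1` [set a])) ->
  (forall n a, measurable (v_ n @^-1` [set a])) ->
  (forall w, exists M, forall n, (M <= n)%N -> u_ n w = u w) ->
  (forall w, exists M, forall n, (M <= n)%N -> v_ n w = v w) ->
  (forall n a, P1 (u_ n @^-1` [set a]) = P2 (v_ n @^-1` [set a])) ->
  forall A, P1 (u @^-1` A) = P2 (v @^-1` A).
Proof.
move=> mu_ mv_ uu vv uv; apply: countable_law_eq.
- by move=> a; exact: (measurable_eventually_eq (fun n => mu_ n a) uu).
- by move=> a; exact: (measurable_eventually_eq (fun n => mv_ n a) vv).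
move=> a; have := probability_eventually_eq (P := P1) (fun n => mu_ n a) uu.
under eq_cvg do rewrite uv.
move=> /cvg_lim <-//; apply/cvg_lim => //.
exact: (probability_eventually_eq (P := P2) (fun n => mv_ n a) vv).
Qed.

Lemma probability_preimage_ae_eq d (O : measurableType d) (T : Type)
    (P : probability O R) (U V : O -> T) (N : set O) (A : set T) :
  measurable N -> P N = 0 -> (forall w, ~ N w -> U w = V w) ->
  measurable (U @^-1` A) -> measurable (V @^-1` A) ->
  P (U @^-1` A) = P (V @^-1` A).
Proof.
move=> mN N0 UV mU mV.
have le B C : measurable B -> measurable C -> B `<=` C `|` N -> (P B <= P C)%E.
  move=> mB mC BC; apply: (@le_trans _ _ (P (C `|` N))).
    by apply: le_measure => //; rewrite inE//; exact: measurableU.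
  by rewrite -[leRHS]adde0 -N0; exact: measureU2.
apply/eqP; rewrite eq_le; apply/andP; split; apply: le => // w /=;
  have [|/UV e] := pselect (N w); [by right|by rewrite /preimage/= e; left|
  by right|by rewrite /preimage/= e; left].
Qed.

End DiscreteLaws.

(** * Jump times and iterated Stieltjes integrals of counting paths *)

Section Jumps.
Context {R : realType}.
Implicit Types (f : cumulative R R) (t tau : R) (p : seq R).

(** A list rather than a set, since a path may jump by more than 1 at once; such a time then occurs
    several times. *)
Definition has_jumps f tau p :=
  all (fun x => 0 < x <= tau) p /\
  forall t, 0 <= t <= tau -> f t = (count (fun x => x <= t) p)%:R.

Lemma count_lt_iota k n : (k <= n)%N -> count (fun i => (i < k)%N) (iota 0 n) = k.
Proof.
move=> kn; rewrite -(subnKC kn) iotaD count_cat add0n.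
rewrite (_ : count _ (iota 0 k) = k); last first.
  rewrite -[RHS](size_iota 0) -count_predT; apply: eq_in_count => i.
  by rewrite mem_iota.
rewrite (_ : count _ _ = 0%N) ?addn0//; apply/eqP.
rewrite eqn0Ngt -has_count -all_predC; apply/allP => i.
by rewrite mem_iota /= -leqNgt => /andP[].
Qed.

(* The jump times are the first passage times at the levels 1, 2, .... *)
Lemma jumps_exist f tau : f 0 = 0 ->
  (forall t, 0 <= t -> exists n : nat, f t = n%:R) -> 0 <= tau ->
  exists p, has_jumps f tau p.
Proof.
move=> f00 fnat tau0; have [n fn] := fnat _ tau0.
pose S i : set R := [set t | 0 <= t <= tau /\ i.+1%:R <= f t].
pose T i := inf (S i).
have ndf : {homo f : x y / x <= y} := cumulative_is_nondecreasing f.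
have Stau i : (i < n)%N -> S i tau by move=> ?; rewrite /S/= tau0 lexx fn ler_nat.
have Slb i : lbound (S i) 0 by move=> t [/andP[]].
have T0 i : (i < n)%N -> 0 <= T i.
  by move=> ni; apply: lb_le_inf; [exists tau; exact: Stau|exact: Slb].
have ST i t : S i t -> T i <= t.
  by move=> Sit; apply: ge_inf => //; exists 0; exact: Slb.
(* If the path were below its level at the infimum, right continuity would keep it below on a right
   neighbourhood, and the infimum would be larger. *)
have fT i : (i < n)%N -> i.+1%:R <= f (T i).
  move=> ni; rewrite leNgt; apply/negP => fTi.
  have e0 : 0 < (i.+1%:R - f (T i)) / 2 by lra.
  have [e fe] := nondecreasing_right_continuousP (T i) f e0.
  have [t Sit tTe] : exists2 t, S i t & t < T i + e%:num.
    by apply: inf_adherent => //; split; [exists tau; exact: Stau|exists 0].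
  have := ndf _ _ (ltW tTe); case: Sit => _ /le_trans h /h{h}.
  by move: fe fTi; lra.
have TP i t : (i < n)%N -> 0 <= t <= tau -> (T i <= t) = (i.+1%:R <= f t).
  move=> ni t0; apply/idP/idP => [/ndf|fti]; last exact: ST.
  by apply: le_trans; exact: fT.
exists (map T (iota 0 n)); split.
  apply/allP => _ /mapP[i] /[!mem_iota]/andP[_ /= ni] ->.
  rewrite ST ?andbT; last exact: Stau.
  rewrite lt_neqAle T0// andbT; apply: contraTN (fT _ ni) => /eqP <-.
  by rewrite f00 -ltNge ltr0n.
move=> t t0; have [k ftk] : exists k : nat, f t = k%:R.
  by apply: fnat; case/andP: t0.
have kn : (k <= n)%N by rewrite -(ler_nat R) -ftk -fn ndf//; case/andP: t0.
rewrite count_map ftk; congr (_%:R).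
rewrite -[LHS](count_lt_iota kn); apply: eq_in_count => i.
by rewrite mem_iota /= => ni; rewrite TP// ftk ler_nat.
Qed.

Definition jumps f tau : seq R := xget [::] [set p | has_jumps f tau p].

Lemma jumpsP f tau : f 0 = 0 ->
  (forall t, 0 <= t -> exists n : nat, f t = n%:R) -> 0 <= tau ->
  has_jumps f tau (jumps f tau).
Proof.
by move=> f00 fnat tau0; apply: xgetPex; exact: (jumps_exist f00 fnat tau0).
Qed.

Lemma count_jumps_itv f tau p s t : has_jumps f tau p ->
  0 <= s -> s <= t -> t <= tau ->
  f t - f s = (count (fun x => s < x <= t) p)%:R.
Proof.
move=> [_ fp] s0 st tT; rewrite !fp; last 2 first.
  by rewrite s0 (le_trans st).
  by rewrite (le_trans s0).
apply/eqP; rewrite subr_eq -natrD eqr_nat -count_predUI; apply/eqP.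
rewrite -[LHS]addn0; congr addn.
  apply: eq_count => x /=; case: (leP x s) => [xs|//].
    by rewrite (le_trans xs st) orbT.
  by rewrite orbF.
apply/esym/eqP; rewrite eqn0Ngt -has_count -all_predC; apply/allP => x _ /=.
by case: (leP x s); rewrite ?andbF.
Qed.

Definition dirac_sum p : {measure set (measurableTypeR R) -> \bar R} :=
  msum (fun i => @dirac _ (measurableTypeR R) (nth 0 p i) R
                  : {measure set (measurableTypeR R) -> \bar R}) (size p).

Lemma lebesgue_stieltjes_itv_oc f a b : a <= b ->
  lebesgue_stieltjes_measure f `]a, b]%classic = (f b - f a)%:E.
Proof.
move=> ab; rewrite /lebesgue_stieltjes_measure /measure_extension/=.
by rewrite measurable_mu_extE/=; [rewrite wlength_itv_bnd|exact: is_ocitv].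
Qed.

Lemma dirac_sum_count p (B : pred R) :
  dirac_sum p [set x | B x] = (count B p)%:R%:E.
Proof.
rewrite /dirac_sum/= /msum; elim: p => [|x p ih]; first by rewrite big_ord0.
rewrite big_ord_recl /= ih diracE -EFinD natrD; congr ((_%:R + _)%:E).
by rewrite /=; apply: congr1; apply/idP/idP; rewrite inE.
Qed.

(** Measures that agree on half-open intervals and are finite on an exhausting sequence of them
    coincide. [has_jumps] controls [f] on [0, tau] only, so the Stieltjes measure is first
    restricted to ]0, tau], where all the Dirac masses sit. *)
Lemma lebesgue_stieltjes_jumps f tau p (A : set (measurableTypeR R)) :
  has_jumps f tau p -> 0 <= tau -> measurable A -> A `<=` `]0, tau]%classic ->
  lebesgue_stieltjes_measure f A = dirac_sum p A.
Proof.
move=> fp tau0 mA A0; have [p0 _] := fp.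
pose m1 : {measure set (measurableTypeR R) -> \bar R} :=
  mrestr (lebesgue_stieltjes_measure f)
    (measurable_itv `]0, tau] : measurable (_ : set (measurableTypeR R))).
rewrite -[A in LHS](setIidl A0) -/(m1 A).
apply: (@measure_unique _ R (measurableTypeR R) (@ocitv R)
  (fun k => `](- k%:R), k%:R]%classic) _ _ _ _ m1 (dirac_sum p) _ _ A mA) => //.
- exact: ocitvI.
- by move=> i; exact: is_ocitv.
- rewrite -subTset => /= x _ /=.
  exists (Num.bound `|x|) => //=; have := archi_boundP (normr_ge0 x).
  by rewrite in_itv/= ltr_norml => /andP[-> /ltW].
- move=> _ [[a b] _ <-] /=; rewrite /mrestr /=.
  rewrite (_ : _ `&` _ = `](Num.max a 0), (Num.min b tau)]%classic); last first.
    apply/seteqP; split => x /=; rewrite !in_itv/= gt_max le_min.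
      by move=> [/andP[-> ->] /andP[-> ->]].
    by move=> /andP[/andP[-> ->] /andP[-> ->]].
  have <- : dirac_sum p `](Num.max a 0), (Num.min b tau)]%classic =
      dirac_sum p `]a, b]%classic.
    rewrite !dirac_sum_count; congr (_%:R%:E); apply: eq_in_count => x.
    move=> /(allP p0) /andP[x0 xt]; rewrite /= !itv_boundlr /= !bnd_simp.
    rewrite gt_max le_min.
    by rewrite x0 xt !andbT.
  have [ab|ab] := leP (Num.max a 0) (Num.min b tau); last first.
    by rewrite set_itv_ge ?measure0// bnd_simp -leNgt ltW.
  rewrite lebesgue_stieltjes_itv_oc// dirac_sum_count.
  rewrite (count_jumps_itv fp)//.
    + by rewrite le_max lexx orbT.
    + by rewrite ge_min lexx orbT.
- move=> k; rewrite /m1/= /mrestr.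
  apply: (@le_lt_trans _ _ (lebesgue_stieltjes_measure f `](- k%:R), k%:R]%classic)).
    by apply: le_measure; rewrite ?inE//; apply: measurableI => //; exact: measurable_itv.
  by rewrite lebesgue_stieltjes_itv_oc ?ltry// lerNl (@le_trans _ _ 0)// oppr_le0.
Qed.

Lemma ge0_integral_jumps f tau p (D : set (measurableTypeR R))
    (g : R -> \bar R) :
  has_jumps f tau p -> 0 <= tau -> measurable D -> D `<=` `]0, tau]%classic ->
  measurable_fun D g -> (forall x, D x -> (0 <= g x)%E) ->
  (\int[lebesgue_stieltjes_measure f]_(x in D) g x =
   \sum_(x <- p) \d_x D * g x)%E.
Proof.
move=> fp tau0 mD D0 mg g0.
rewrite (eq_measure_integral (dirac_sum p)); last first.
  move=> A mA AD; apply: (lebesgue_stieltjes_jumps fp) => //.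
  exact: subset_trans AD D0.
rewrite ge0_integral_measure_sum// (big_nth 0) big_mkord.
by apply: eq_bigr => i _; rewrite integral_dirac.
Qed.

Lemma measurable_count_words d (O : measurableType d) (T : Type)
    (L : seq (seq T)) (D : set O) (G : O -> pred (seq T)) :
  (forall h, measurable_fun D (fun u => G u h)) ->
  measurable_fun D (fun u => (count (G u) L)%:R%:E : \bar R).
Proof.
move=> mG; apply/measurable_EFinP; elim: L => [|h L ih] /=.
  exact: measurable_cst.
under eq_fun do rewrite natrD; apply: measurable_funD => //.
apply: (measurableT_comp (f := fun b : bool => b%:R : R)) => //.
Qed.

Lemma measurable_sorted_rcons (D : set R) (h : seq R) : measurable D ->
  measurable_fun D (fun u => sorted <%R (rcons h u)).
Proof.
move=> mD; case: h => [|x h] /=; first exact: measurable_cst.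
under eq_fun do rewrite rcons_path.
by apply: measurable_and => //; exact: measurable_fun_ltr.
Qed.

(** Each integral becomes a sum over jump times and appends one letter to the words; the open upper
    limit of []0, s[] is what makes the inequalities strict. *)
Lemma iterated_integral_count (dN : nat -> cumulative R R) tau
    (P : nat -> seq R) m s :
  (forall l, (0 < l <= m)%N -> has_jumps (dN l) tau (P l)) -> 0 <= tau ->
  s <= tau ->
  iterated_integral dN m s =
  (count (fun h => sorted <%R (rcons h s)) (words P m))%:R%:E.
Proof.
move=> dNP tau0; elim: m dNP s => [|m ih] dNP s st /=; first by [].
have {}ih u : u <= tau -> iterated_integral dN m u =
    (count (fun h => sorted <%R (rcons h u)) (words P m))%:R%:E.
  by apply: (ih _ u) => l /andP[l0 lm]; apply: dNP; rewrite l0 leqW.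
rewrite -/(words P m.+1) count_wordsS.
have Pm : has_jumps (dN m.+1) tau (P m.+1) by apply: dNP; rewrite leqnn.
under eq_integral.
  move=> u; rewrite inE/= in_itv/= => /andP[_ us].
  rewrite ih; last exact: le_trans (ltW us) st.
  over.
rewrite (ge0_integral_jumps Pm)//; first last.
- apply: measurable_count_words => h; exact: measurable_sorted_rcons.
- by move=> x /=; rewrite !in_itv/= => /andP[-> /ltW xs]; exact: le_trans xs st.
rewrite (big_morph (fun n => n%:R%:E) (id1 := 0%E) (op1 := +%E)) //; last first.
  by move=> a b; rewrite natrD EFinD.
apply: eq_big_seq => y yP; rewrite diracE /=.
have /andP[y0 _] := allP Pm.1 _ yP.
rewrite -EFinM -natrM; congr (_%:R%:E).
rewrite (_ : (y \in _) = (y < s)); last first.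
  by apply/idP/idP; rewrite inE/= in_itv/= y0.
(* Adding [s] after [y] brings one new comparison, [y < s], which is the Dirac factor of []0, s[] at
   the positive time [y]. *)
have srt h : sorted <%R (rcons (rcons h y) s) = (y < s) && sorted <%R (rcons h y).
  case: h => [|x h]; first by rewrite /= !andbT.
  by rewrite !rcons_cons /= rcons_path last_rcons andbC.
under [in RHS]eq_count do rewrite srt.
by case: (y < s); rewrite ?mul1n// mul0n; elim: words.
Qed.

Lemma iterated_integral_closed_count (dN : nat -> cumulative R R) tau
    (P : nat -> seq R) m :
  (forall l, (0 < l <= m.+1)%N -> has_jumps (dN l) tau (P l)) -> 0 <= tau ->
  iterated_integral_closed dN m tau =
  (count (sorted <%R) (words P m.+1))%:R%:E.
Proof.
move=> dNP tau0; rewrite /iterated_integral_closed count_wordsS.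
have Pm : has_jumps (dN m.+1) tau (P m.+1) by apply: dNP; rewrite leqnn.
under eq_integral.
  move=> u; rewrite inE/= in_itv/= => /andP[_ us].
  rewrite (@iterated_integral_count _ tau P)//; last first.
    by move=> l /andP[l0 lm]; apply: dNP; rewrite l0 leqW.
  over.
rewrite (ge0_integral_jumps Pm)//; first last.
- apply: measurable_count_words => h; exact: measurable_sorted_rcons.
rewrite (big_morph (fun n => n%:R%:E) (id1 := 0%E) (op1 := +%E)) //; last first.
  by move=> a b; rewrite natrD EFinD.
(* All jump times lie in []0, tau]], so the closed outer limit discards nothing and every Dirac
   factor is 1. *)
apply: eq_big_seq => y yP; rewrite diracE mem_set ?mul1e//=.
by rewrite in_itv/=; exact: allP Pm.1 _ yP.
Qed.

End Jumps.

(** * Reflected intensities *)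

Section Intensities.
Context {R : realType}.
Implicit Types (f : R -> R) (r s t : R).
Local Notation mu := (@lebesgue_measure R).

Lemma lebesgue_measure_reflect c (A : set R) : measurable A ->
  pushforward mu (fun x : measurableTypeR R => c - x : measurableTypeR R) A = mu A.
Proof.
have mc : measurable_fun setT (fun x : measurableTypeR R => c - x : measurableTypeR R).
  exact: measurable_funB.
move=> mA; apply/esym/lebesgue_measure_unique => //= _ [[a b]] _ <-.
(* Reflection moves the closed end to the other side and keeps the length, which determines the
   measure. *)
rewrite /pushforward /= (_ : _ @^-1` _ = `[c - b, c - a[%classic); last first.
  apply/seteqP; split => x /=; rewrite !in_itv/= => /andP[? ?];
    apply/andP; split; lra.
rewrite !lebesgue_measure_itv/= !lte_fin; case: ifPn => ab; case: ifPn => ab' //.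
- by rewrite -!EFinB; congr _%:E; lra.
- by exfalso; lra.
- by exfalso; lra.
Qed.

Lemma ge0_integral_reflect c (D : set R) (g : R -> \bar R) : measurable D ->
  measurable_fun D g -> (forall x, D x -> (0 <= g x)%E) ->
  (\int[mu]_(x in D) g x =
   \int[mu]_(x in [set x | D (c - x)%R]) g (c - x)%R)%E.
Proof.
move=> mD mg g0.
have mc : measurable_fun setT (fun x : measurableTypeR R => c - x : measurableTypeR R).
  exact: measurable_funB.
rewrite -[RHS](@ge0_integral_pushforward _ _ _ _ _ _ mc mu D g mD mg).
  apply: eq_measure_integral => A mA _.
  exact/esym/lebesgue_measure_reflect.
by move=> x /set_mem; exact: g0.
Qed.

Section Reflected.
Variables (r : R) (f : R -> R).
Hypothesis f0 : forall s, 0 <= s <= r -> 0 <= f s.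
Hypothesis f_int : mu.-integrable `[0, r] (EFin \o f).

Lemma measurable_reflected_density :
  measurable_fun `[0, r] (fun s => (f (r - s))%:E).
Proof.
apply: (@measurable_comp _ _ _ _ _ _ `[0, r]%classic (EFin \o f) _ (fun s => r - s)).
- exact: measurable_itv.
- by move=> _ [x /= + <-]; rewrite !in_itv/= => /andP[? ?]; apply/andP; split; lra.
- exact: measurable_int f_int.
- by apply: measurable_funTS; exact: measurable_funB.
Qed.

Lemma reflected_density_ge0 s : `[0, r]%classic s -> (0 <= (f (r - s))%:E)%E.
Proof.
rewrite /= in_itv/= => /andP[? ?]; rewrite lee_fin; apply: f0.
by apply/andP; split; lra.
Qed.

Lemma reflected_intensity_ge0 B : (0 <= reflected_intensity r f B)%E.
Proof. by apply: integral_ge0 => x [_]; exact: reflected_density_ge0. Qed.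

Lemma le_reflected_intensity (A B : set R) : measurable A -> measurable B ->
  A `<=` B -> (reflected_intensity r f A <= reflected_intensity r f B)%E.
Proof.
move=> mA mB AB; apply: ge0_subset_integral => //.
- exact: measurableI.
- exact: measurableI.
- apply: measurable_funS measurable_reflected_density => //.
- by move=> x [_]; exact: reflected_density_ge0.
- exact: setSI.
Qed.

Lemma reflected_intensity_fin (B : set R) : measurable B ->
  (reflected_intensity r f B < +oo)%E.
Proof.
move=> mB; apply: le_lt_trans (le_reflected_intensity mB (measurableT) (@subsetT _ _)) _.
rewrite /reflected_intensity setTI.
have /integrableP[_] := f_int; apply: le_lt_trans.
rewrite (ge0_integral_reflect r)//; last 2 first.
- exact: measurable_reflected_density.
- exact: reflected_density_ge0.
rewrite (_ : [set x | _] = `[0, r]%classic).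
  rewrite le_eqVlt; apply/orP; left; apply/eqP/eq_integral => x.
  rewrite inE/= in_itv/= => xr; rewrite ger0_norm ?f0//.
  by congr (f _)%:E; lra.
by apply/seteqP; split => x /=; rewrite !in_itv/= => /andP[? ?];
  apply/andP; split; lra.
Qed.

Lemma reflected_intensity_sum K (B : nat -> set R) :
  (forall j, measurable (B j)) -> trivIset setT B ->
  (\sum_(j < K) reflected_intensity r f (B j) <= reflected_intensity r f setT)%E.
Proof.
move=> mB tB; rewrite /reflected_intensity.
rewrite -(big_mkord xpredT (fun j =>
  (\int[mu]_(s in B j `&` `[0%R, r]) (f (r - s)%R)%:E)%E)) /index_iota subn0.
pose F j := B j `&` `[0, r]%classic.
have mF j : measurable (F j) by exact: measurableI.
have DF : \big[setU/set0]_(j <- iota 0 K) F j `<=` `[0, r]%classic.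
  rewrite big_seq; elim/big_ind : _ => //.
    by move=> A A' ? ?; rewrite subUset.
  by move=> j _; exact: subIsetr.
apply: (@le_trans _ _ (\int[mu]_(s in \big[setU/set0]_(j <- iota 0 K) F j)
    (f (r - s)%R)%:E)%E).
  rewrite (ge0_integral_bigsetU mu mF (iota_uniq 0 K))//.
  - apply/trivIsetP => i j _ _ ij; rewrite /F setIACA.
    by move/trivIsetP : tB => /(_ i j I I ij) ->; rewrite set0I.
  - by apply: measurable_funS measurable_reflected_density.
  - by move=> x /DF; exact: reflected_density_ge0.
rewrite setTI; apply: ge0_subset_integral => //.
- by apply: bigsetU_measurable => j _; exact: mF.
- exact: measurable_reflected_density.
- exact: reflected_density_ge0.
Qed.

(** Absolute continuity of the integral, applied to the density extended by 0 outside [0, r]. It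
    bounds the masses of all thin cells by one constant, which is what makes ties negligible. *)
Lemma reflected_intensity_small (e : R) : 0 < e -> exists2 d : R, 0 < d &
  forall A : set R, measurable A -> (mu A < d%:E)%E ->
    (reflected_intensity r f A <= e%:E)%E.
Proof.
move=> e0; pose h := (fun s => f (r - s)) \_ `[0, r]%classic.
have h_int : mu.-integrable setT (EFin \o h).
  rewrite /h -restrict_EFin.
  apply: (proj1 (@integrable_mkcond _ _ _ mu _ _ (measurable_itv `[0, r]))).
  apply/integrableP; split; first exact: measurable_reflected_density.
  rewrite (eq_integral (fun s : measurableTypeR R => (f (r - s))%:E)); last first.
    by move=> s /set_mem /reflected_density_ge0; rewrite /= lee_fin => ?; rewrite ger0_norm.
  have := reflected_intensity_fin measurableT.
  by rewrite /reflected_intensity setTI.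
have [d [d0 hd]] := integral_normr_continuous h_int e0.
exists d => // A mA Ad; have := hd _ mA Ad.
have <- : fine (reflected_intensity r f A) = (\int[mu]_(x in A) `|h x|)%R.
  rewrite /Rintegral /reflected_intensity; congr fine.
  rewrite integral_mkcondr; apply: eq_integral => x _.
  rewrite /h !patchE; case: ifPn => [/set_mem/reflected_density_ge0|]; last by rewrite normr0.
  by rewrite lee_fin => ?; rewrite ger0_norm.
move=> /ltW; rewrite -lee_fin fineK//.
by rewrite ge0_fin_numE ?reflected_intensity_fin ?reflected_intensity_ge0.
Qed.

End Reflected.

(** The change of variable [x = l r - s] turns the forward coordinate [x - (l-1) r] into [r - s],
    and inside cell [l] all other summands of [node_density] vanish. *)
Lemma node_intensity_cell r k (lam : nat -> R -> R) l s t : 0 < r ->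
  (0 < l <= k)%N ->
  (forall s : R, 0 <= s <= r -> 0 <= lam l s) ->
  mu.-integrable `[0, r] (EFin \o lam l) ->
  0 <= s -> s <= t -> t <= r ->
  node_intensity r k lam `[l%:R * r - t, l%:R * r - s[ =
  reflected_intensity r (lam l) `]s, t].
Proof.
move=> r0 lk l0 li s0 st tr; rewrite /node_intensity /reflected_intensity.
have str : `]s, t]%classic `<=` `[0, r]%classic.
  move=> x /=; rewrite !in_itv/= => /andP[? ?].
  by apply/andP; split; lra.
have mst : measurable_fun `]s, t[ (fun u => (lam l (r - u))%:E).
  apply: measurable_funS (measurable_reflected_density li) => //.
  by apply: subset_trans str; move=> x /=; rewrite !in_itv/= => /andP[-> /ltW].
have density x : l%:R * r - t < x -> x < l%:R * r - s ->
    node_density r k lam x = lam l (r - (l%:R * r - x)).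
  move=> xt xs; have /andP[l1 lk'] := lk.
  have lr : l.-1%:R * r = l%:R * r - r :> R.
    by rewrite -[in RHS](prednK l1) -natr1 mulrDl mul1r addrK.
  rewrite /node_density (bigD1_seq l)/= ?mem_index_iota ?iota_uniq ?ltnS//=.
  rewrite indicE mem_set /=; last first.
    by rewrite in_itv/= lr; apply/andP; split; lra.
  rewrite big1 ?addr0; first by rewrite mul1r lr; congr lam; lra.
  move=> i il; rewrite indicE memNset ?mul0r//= in_itv/= => /andP[h1 h2].
  case: (ltngtP i l) il => // [il|li'] _.
    have : i%:R <= l.-1%:R :> R by rewrite ler_nat -ltnS prednK.
    by rewrite -(ler_pM2r r0) lr; lra.
  have : l%:R <= i.-1%:R :> R by rewrite ler_nat -ltnS prednK// (leq_trans _ li').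
  by rewrite -(ler_pM2r r0); lra.
(* For [t = r] the left end [(l-1) r] lies outside cell [l], so the formula for the density is
   available in the interior only; both integrals are therefore taken over open intervals, which
   changes neither. *)
rewrite (setIidl str) -integral_itv_bndo_bndc//.
rewrite [RHS](ge0_integral_reflect (l%:R * r))//; last first.
  move=> x xst; apply: (reflected_density_ge0 l0); apply: str.
  by move: xst => /=; rewrite !in_itv/= => /andP[-> /ltW].
rewrite (_ : [set x | `]s, t[%classic (l%:R * r - x)] =
    `](l%:R * r - t), (l%:R * r - s)[%classic); last first.
  by apply/seteqP; split => x /=; rewrite !in_itv/= => /andP[? ?];
    apply/andP; split; lra.
rewrite -integral_itv_obnd_cbnd.
  apply: eq_integral => x; rewrite inE/= in_itv/= => /andP[? ?].
  by rewrite density.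
apply: (eq_measurable_fun
  (fun x : measurableTypeR R => (lam l (r - (l%:R * r - x)))%:E)).
  by move=> x; rewrite inE/= in_itv/= => /andP[? ?]; rewrite density.
suff : measurable_fun `](l%:R * r - t), (l%:R * r - s)[
    (fun x : R => (lam l (r - (l%:R * r - x)))%:E) by [].
have mg : measurable_fun `](l%:R * r - t), (l%:R * r - s)[ (fun x : R => l%:R * r - x).
  by apply: measurable_funTS; exact: measurable_funB.
apply: (measurable_comp (measurable_itv `]s, t[) _ mst mg) => //.
move=> _ [x /= + <-]; rewrite !in_itv/= => /andP[? ?].
by apply/andP; split; lra.
Qed.

Lemma node_intensity_set1 r k (lam : nat -> R -> R) x :
  node_intensity r k lam [set x] = 0%E.
Proof. exact: integral_set1. Qed.

End Intensities.

(** * Geometry of k-hops *)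

Section Geometry.
Context {R : realType}.
Implicit Types (r t tau x y : R) (h s : seq R).

Definition is_khop r t h : bool :=
  uniq h && path (connected_nodes r) 0 (rcons h t).

(** The positions whose reflection [l r - x] lies in ]0, tau], the range of the outer integral;
    hence the half-open shape. *)
Definition in_cell r tau l : pred R := fun x => l%:R * r - tau <= x < l%:R * r.

Definition backward r l x : R := l%:R * r - x.

Lemma path_connected_le r t x h : path (connected_nodes r) x (rcons h t) ->
  t - x <= (size h).+1%:R * r.
Proof.
elim: h x => [|y h ih] x /=.
  by rewrite andbT /connected_nodes ler_norml mul1r => /andP[].
rewrite {1}/connected_nodes ler_norml => /andP[/andP[_ xy] /ih].
by rewrite -(natr1 (size h).+1) mulrDl mul1r; lra.
Qed.

Section Good.
Variables (r tau : R) (m : nat) (S : seq R).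
Hypotheses (r0 : 0 < r) (tau0 : 0 <= tau) (taur : tau <= r).
Hypothesis S_end : forall l, (0 < l <= m)%N -> l%:R * r \notin S.
Hypothesis S_tie : forall l x, (0 < l < m)%N -> in_cell r tau l x ->
  x \in S -> x + r \notin S.
Local Notation t := (m.+1%:R * r - tau).

(** Because [tau <= r], the cells are disjoint and ordered: [x < l r <= (l+1) r - tau <= y]. A word
    through successive cells thus has distinct letters. *)
Lemma walkall_in_cell_sorted x l h : in_cell r tau l x ->
  walkall (in_cell r tau) l h -> path <%R x h.
Proof.
elim: h x l => //= y h ih x l xl /andP[yl hl]; rewrite (ih _ _ yl hl) andbT.
move: xl yl; rewrite /in_cell -natr1 mulrDl mul1r => /andP[_ ?] /andP[? _].
by have := taur; lra.
Qed.

(** Being in cell [l] with just enough hops left forces the next node into cell [l+1]. There a hop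
    of length at most [r] means that the reflected time does not decrease, hence that it increases
    once ties are excluded. *)
Lemma path_connected_backward x l h : (0 < l)%N -> (l + size h = m)%N ->
  x \in S -> all (mem S) h -> in_cell r tau l x ->
  path (connected_nodes r) x (rcons h t) =
  walkall (in_cell r tau) l h &&
  path <%R (backward r l x) (walkmap (backward r) l h).
Proof.
elim: h x l => [|y h ih] x l l0 lm xS hS xl /=.
  (* The hop to [t] is automatic: from cell [m] its length lies between [r - tau] and [r]. *)
  have := taur; have := tau0; move: lm xl; rewrite addn0 andbT /connected_nodes /in_cell => -> /andP[x1 x2].
  by rewrite ler_norml -natr1 mulrDl mul1r => ? ?; apply/andP; split; lra.
move: hS => /= /andP[yS hS].
have lm' : (l < m)%N by rewrite -lm /= addnS ltnS leq_addr.
have lSr : l.+1%:R * r = l%:R * r + r by rewrite -natr1 mulrDl mul1r.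
have [yl|yl] := boolP (in_cell r tau l.+1 y); last first.
  (* Squeeze: the hop from [x] gives [y < (l+1) r], and the [size h + 1] hops left to [t] give
     [y >= (l+1) r - tau]. *)
  apply/negbTE; apply: contra yl => /andP[xy /path_connected_le].
  move: xy xl; rewrite /connected_nodes ler_norml /in_cell => /andP[xy1 xy2].
  move=> /andP[xl1 xl2] yt; rewrite lSr; apply/andP; split; last lra.
  move: yt; rewrite -lm /= addnS -addSn -addnS natrD mulrDl lSr; lra.
rewrite (ih y l.+1)//; last by rewrite addSn -lm /= addnS.
rewrite /= andbCA; congr (_ && (_ && _)).
have yxr : y != x + r.
  apply: contraTneq yS => ->; apply: (@S_tie l) => //.
  by rewrite l0.
move: xl yl; rewrite /in_cell /connected_nodes /backward lSr => /andP[? ?] /andP[? ?].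
rewrite ger0_norm; last by have := taur; lra.
rewrite le_eqVlt (_ : (y - x == r) = false) /=; last first.
  by apply/negbTE; rewrite subr_eq addrC.
by apply/idP/idP => ?; lra.
Qed.

(** The first node is treated apart, because the path starts at 0 and not at a node: it satisfies
    [x <= r], and [S_end] makes this strict, which the later hops pass on. *)
Lemma is_khop_backward h : (0 < m)%N -> size h = m -> all (mem S) h ->
  is_khop r t h =
  walkall (in_cell r tau) 0 h && sorted <%R (walkmap (backward r) 0 h).
Proof.
case: h => [|x h] m0 hm hS; first by move: m0; rewrite -hm.
have /andP[xS hS'] := hS.
have xr : x != r.
  by apply: contraTneq xS => ->; rewrite -[X in X \notin _]mul1r; exact: (@S_end 1).
rewrite /is_khop [path _ _ _]/= [walkall _ _ _]/= [sorted _ _]/=.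
have [x1|x1] := boolP (in_cell r tau 1 x); last first.
  rewrite andFb; apply/negbTE; apply: contra x1 => /and3P[_ x1 /path_connected_le].
  move: x1; rewrite /connected_nodes subr0 ler_norml -hm /= => /andP[_].
  rewrite le_eqVlt (negbTE xr) /= /in_cell mul1r => -> /=.
  by rewrite andbT -(natr1 (size h).+1) mulrDl mul1r; lra.
rewrite (@path_connected_backward x 1)//.
have -> : connected_nodes r 0 x.
  move: x1; rewrite /in_cell /connected_nodes subr0 mul1r => /andP[? ?].
  by have := taur; have := r0; rewrite ler_norml => ? ?; apply/andP; split; lra.
case wh : (walkall _ _ _); last by rewrite /= !andbF.
have /lt_path_min/allP xh := walkall_in_cell_sorted x1 wh.
have := walkall_in_cell_sorted x1 wh; move=> srt.
by rewrite (lt_sorted_uniq (s := x :: h)).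
Qed.

Lemma count_is_khop : (0 < m)%N ->
  count (is_khop r t) (words (fun=> S) m) =
  count (sorted <%R)
    (words (fun l => [seq backward r l x | x <- S & in_cell r tau l x]) m).
Proof.
move=> m0; rewrite count_words_map_filter; apply: eq_in_count => h.
rewrite mem_words_const => /andP[/eqP hm hS].
exact: is_khop_backward.
Qed.

End Good.

Lemma khop_count_words r (X : set R) k t : finite_set X ->
  khop_count r X k t =
  (count (is_khop r t) (words (fun=> fset_set X) k.-1))%:R%:E.
Proof.
move=> fX; rewrite /khop_count /counting.
pose L := [seq h <- words (fun=> enum_fset (fset_set X)) k.-1 | is_khop r t h].
(* Retyping the words as tuples loses none of them, since they all have size [k.-1]. *)
pose L' : seq (k.-1.-tuple R) := pmap insub L.
have XL : @khops R r X k t = [set` L'].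
  apply/seteqP; split => x /=; rewrite /L' mem_pmap_sub mem_filter mem_words_const.
    case=> ux xX px; rewrite size_tuple eqxx /is_khop ux px /=.
    by apply/allP => y yx /=; rewrite in_fset_set// mem_set//; exact: xX.
  move=> /andP[/andP[ux px] /andP[_ /allP xX]]; split => // y /xX /=.
  by rewrite in_fset_set// inE.
have fXL : finite_set (@khops R r X k t) by rewrite XL; exact: finite_seq.
case: asboolP => // _; congr (_%:R%:E).
rewrite -size_filter -/L.
have -> : size L = size L'.
  rewrite size_pmap_sub; apply/esym/eqP; rewrite -all_count; apply/allP => h.
  by rewrite mem_filter mem_words_const => /and3P[_ + _].
apply: perm_size; apply: uniq_perm.
- exact: fset_uniq.
- apply: pmap_sub_uniq; apply: filter_uniq.
  by apply: words_const_uniq; exact: fset_uniq.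
- by move=> x; rewrite in_fset_set// XL; apply/idP/idP; rewrite inE.
Qed.

Lemma point_count_seq d (O : measurableType d) (X : O -> set R) (B : set R) w
    (p : pred R) : finite_set (X w) ->
  (forall x, X w x -> B x <-> p x) ->
  Defs.count X B w = count p (fset_set (X w)).
Proof.
move=> fX Bp; rewrite /Defs.count -size_filter; apply: perm_size; apply: uniq_perm.
- exact: fset_uniq.
- by apply: filter_uniq; exact: fset_uniq.
move=> x; rewrite mem_filter !in_fset_set//; last exact: finite_setIl.
apply/idP/idP.
  by rewrite inE => -[Xx Bx]; apply/andP; split; [exact/Bp|rewrite inE].
by case/andP=> px /[!inE] Xx; split => //; exact/Bp.
Qed.

End Geometry.

(** * Word polynomials in random counts *)

Section RandomWordPoly.
Context {R : realType}.

(** Only finitely many counts enter [word_poly]; packing them into a finite function gives a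
    countable type, on which a law is determined by its atoms. Letters are numbered from 1 and
    ordinals from 0, hence [l.-1]. *)
Definition extend_vector m K (v : {ffun 'I_m * 'I_K -> nat}) (l j : nat) : nat :=
  if insub l.-1 is Some i then if insub j is Some i' then v (i, i') else 0%N
  else 0%N.

Lemma extend_vectorE m K (c : nat -> nat -> nat) g :
  word_poly K c g m =
  word_poly K (extend_vector [ffun p : 'I_m * 'I_K => c p.1.+1 p.2]) g m.
Proof.
apply: eq_word_poly => -[//|l] j /= lm jK; rewrite /extend_vector /=.
by rewrite (insubT (fun i => (i < m)%N) lm) (insubT (fun i => (i < K)%N) jK) ffunE.
Qed.

Lemma ffun_preimage O m K (c : O -> nat -> nat -> nat)
    (v : {ffun 'I_m * 'I_K -> nat}) :
  (fun w => [ffun p : 'I_m * 'I_K => c w p.1.+1 p.2]) @^-1` [set v] =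
  \bigcap_(p in [set: 'I_m * 'I_K]) [set w | c w p.1.+1 p.2 = v p].
Proof.
apply/seteqP; split => w /=.
  by rewrite /preimage/= => /ffunP wv p _; rewrite /= -wv ffunE.
by move=> h; apply/ffunP => p; rewrite ffunE; exact: h.
Qed.

Lemma word_poly_preimage O m K (c : O -> nat -> nat -> nat) g (A : set nat) :
  (fun w => word_poly K (c w) g m) @^-1` A =
  (fun w => [ffun p : 'I_m * 'I_K => c w p.1.+1 p.2]) @^-1`
    [set v | A (word_poly K (extend_vector v) g m)].
Proof.
by apply/seteqP; split => w; rewrite /preimage/= -(@extend_vectorE m K (c w)).
Qed.

Lemma measurable_ffun_preimage d (O : measurableType d) m K
    (c : O -> nat -> nat -> nat) (v : {ffun 'I_m * 'I_K -> nat}) :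
  (forall (p : 'I_m * 'I_K) a, measurable [set w | c w p.1.+1 p.2 = a]) ->
  measurable ((fun w => [ffun p : 'I_m * 'I_K => c w p.1.+1 p.2]) @^-1` [set v]).
Proof.
move=> mc; rewrite ffun_preimage; apply: fin_bigcap_measurable.
  exact: finite_finset.
by move=> p _; exact: mc.
Qed.

Lemma measurable_word_poly d (O : measurableType d) m K
    (c : O -> nat -> nat -> nat) g A :
  (forall (p : 'I_m * 'I_K) a, measurable [set w | c w p.1.+1 p.2 = a]) ->
  measurable ((fun w => word_poly K (c w) g m) @^-1` A).
Proof.
move=> mc; rewrite word_poly_preimage; apply: measurable_countable_preimage => v.
exact: measurable_ffun_preimage.
Qed.

Lemma word_poly_law_eq d1 d2 (O1 : measurableType d1) (O2 : measurableType d2)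
    (P1 : probability O1 R) (P2 : probability O2 R) m K
    (c1 : O1 -> nat -> nat -> nat) (c2 : O2 -> nat -> nat -> nat) g A :
  (forall (p : 'I_m * 'I_K) a, measurable [set w | c1 w p.1.+1 p.2 = a]) ->
  (forall (p : 'I_m * 'I_K) a, measurable [set w | c2 w p.1.+1 p.2 = a]) ->
  (forall v : 'I_m * 'I_K -> nat,
    P1 (\bigcap_(p in [set: 'I_m * 'I_K]) [set w | c1 w p.1.+1 p.2 = v p]) =
    P2 (\bigcap_(p in [set: 'I_m * 'I_K]) [set w | c2 w p.1.+1 p.2 = v p])) ->
  P1 ((fun w => word_poly K (c1 w) g m) @^-1` A) =
  P2 ((fun w => word_poly K (c2 w) g m) @^-1` A).
Proof.
move=> m1 m2 P12; rewrite !word_poly_preimage; apply: countable_law_eq => v.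
- exact: measurable_ffun_preimage.
- exact: measurable_ffun_preimage.
- by rewrite !ffun_preimage.
Qed.

End RandomWordPoly.

(** * The grid on [0, tau] and the law of Poisson increments *)

Section Grid.
Context {R : realType}.
Variables (tau : R) (n : nat).

(** Truncation at [tau] keeps the last, incomplete cell inside [0, tau] and makes the later ones
    empty. As [0.-1] is 0, cell 0 is empty too, in agreement with [cell n x] being positive for
    [x > 0]. *)
Definition grid (j : nat) : R := Num.min tau (j%:R / n.+1%:R).

Lemma grid_le j : grid j <= tau.
Proof. by rewrite ge_min lexx. Qed.

Lemma grid_mono i j : (i <= j)%N -> grid i <= grid j.
Proof.
by move=> ij; rewrite /grid le_min ge_min lexx /= ge_min ler_pM2r// ler_nat ij orbT.
Qed.

Hypothesis tau0 : 0 <= tau.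

Lemma grid_ge0 j : 0 <= grid j.
Proof. by rewrite le_min tau0 /= divr_ge0. Qed.

Lemma grid0 : grid 0 = 0.
Proof. by rewrite /grid mul0r; apply/min_idPr. Qed.

Lemma grid_step j : grid j - grid j.-1 <= n.+1%:R^-1.
Proof.
case: j => [|j] /=; first by rewrite subrr invr_ge0.
rewrite lerBlDr /grid -(natr1 j) mulrDl mul1r.
have h : 0 <= n.+1%:R^-1 :> R by rewrite invr_ge0.
rewrite ge_min; case: (leP tau (j%:R / n.+1%:R)) => _; apply/orP; [left|right].
  by rewrite lerDr.
by rewrite addrC.
Qed.

Lemma cell_gridE x j : 0 < x <= tau ->
  (cell n x == j) = (grid j.-1 < x <= grid j).
Proof.
move=> /andP[x0 xt]; rewrite (cell_eq n j (ltW x0)); case: j => [|j] /=.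
  by rewrite grid0 x0 /= [x <= 0]leNgt x0 andbC leNgt mulr_gt0.
rewrite -(natr1 j) addrK /grid gt_min le_min xt /= ltNge xt /=.
by rewrite ltr_pdivrMr// ler_pdivlMr// natr1.
Qed.

End Grid.

Section ProcessLaw.
Context {R : realType} {d : measure_display} {O : measurableType d}.
Variable Q : probability O R.

Lemma sigma_of_process_increment (N : O -> cumulative R R) (s t a : R) :
  0 <= s -> 0 <= t -> sigma_of_process N [set w | N w t - N w s = a].
Proof.
move=> s0 t0.
pose G := \bigcup_(t in [set t : R | 0 <= t]) sigma_of (fun w => N w t : R).
have mN u : 0 <= u ->
    measurable_fun setT (fun w : g_sigma_algebraType G => N w u : R).
  move=> u0 _ B mB; apply: sub_sigma_algebra; exists u => //.
  by exists B.
have := measurable_funB (mN _ t0) (mN _ s0).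
by move=> /(_ measurableT [set a] (measurable_set1 a)); rewrite setTI.
Qed.

Lemma poisson_increments_law (N : O -> cumulative R R) Lam n K tau
    (v : 'I_K -> nat) : poisson_process Q N Lam -> 0 <= tau ->
  Q (\bigcap_(j in [set: 'I_K])
       [set w | N w (grid tau n j) - N w (grid tau n j.-1) = (v j)%:R]) =
  (\prod_(j < K) poisson_prob
     (fine (Lam `](grid tau n j.-1), (grid tau n j)]%classic)) 0%N [set v j])%E.
Proof.
move=> [_ _ _ Nlaw Nind] tau0.
(* The times are shifted by one, [t i = grid i.-1], so that increment number [i] belongs to cell
   [i]; the first one is over the empty cell 0. *)
have := Nind K (fun i => grid tau n i.-1) _ _ [set: 'I_K]%SET.
move=> /(_ (grid_ge0 n tau0 0)).
have ndg : nondecreasing_seq (fun i => grid tau n i.-1).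
  by move=> i j ij; apply: grid_mono; rewrite -!subn1 leq_sub2r.
move=> /(_ ndg (fun j : 'I_K =>
  [set w | N w (grid tau n j) - N w (grid tau n j.-1) = (v j)%:R])).
rewrite (_ : [set` [set: 'I_K]%SET] = [set: 'I_K]); last first.
  by apply/seteqP; split => i //= _; rewrite finset.in_setT.
move=> ->; last first.
  move=> j _; exists [set (v j)%:R]; first exact: measurable_set1.
  by rewrite setTI.
apply: eq_big => [j|j _]; first by rewrite finset.in_setT.
by apply: Nlaw; [exact: grid_ge0|apply: grid_mono; exact: leq_pred].
Qed.

Lemma poisson_family_law m (N : nat -> O -> cumulative R R)
    (Lam : nat -> set R -> \bar R) n K tau (v : 'I_m * 'I_K -> nat) :
  (forall l, (0 < l <= m)%N -> poisson_process Q (N l) (Lam l)) ->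
  mutually_independent Q (fun l : 'I_m => sigma_of_process (N l.+1)) ->
  0 <= tau ->
  Q (\bigcap_(p in [set: 'I_m * 'I_K])
       [set w | N p.1.+1 w (grid tau n p.2) - N p.1.+1 w (grid tau n p.2.-1) =
                (v p)%:R]) =
  (\prod_(p : 'I_m * 'I_K) poisson_prob
     (fine (Lam p.1.+1 `](grid tau n p.2.-1), (grid tau n p.2)]%classic))
     0%N [set v p])%E.
Proof.
move=> NL Nind tau0.
pose E (l : 'I_m) := \bigcap_(j in [set: 'I_K])
  [set w | N l.+1 w (grid tau n j) - N l.+1 w (grid tau n j.-1) = (v (l, j))%:R].
(* Independence of the processes gives a product over [l], independence of increments a product over
   the cells of each. *)
rewrite (_ : \bigcap_(_ in _) _ = \bigcap_(l in [set` [set: 'I_m]%SET]) E l).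
  rewrite Nind; last first.
    move=> l _.
    pose G := \bigcup_(t in [set t : R | 0 <= t]) sigma_of (fun w => N l.+1 w t : R).
    have : measurable (E l : set (g_sigma_algebraType G)).
      apply: fin_bigcap_measurable; first exact: finite_finset.
      by move=> j _; apply: sigma_of_process_increment; exact: grid_ge0.
    by [].
  pose F (l : 'I_m) (j : 'I_K) := poisson_prob
    (fine (Lam l.+1 `](grid tau n j.-1), (grid tau n j)]%classic)) 0%N
    [set v (l, j)].
  transitivity (\prod_(l < m) \prod_(j < K) F l j)%E; last first.
    by rewrite pair_bigA; apply: eq_bigr => -[l j] _.
  apply: eq_big => [l|l _]; first by rewrite finset.in_setT.
  rewrite /E (@poisson_increments_law (N l.+1) (Lam l.+1))//.
  by apply: NL; rewrite /= ltn_ord.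
apply/seteqP; split => w /=.
  by move=> h l _ j _ /=; exact: (h (l, j)).
by move=> h [l j] _ /=; apply: (h l) => //; rewrite /= finset.in_setT.
Qed.

End ProcessLaw.

(** * Counts of a Poisson point process *)

Section PoissonProb.
Context {R : realType}.

Lemma poisson_prob0 (x : R) : 0 <= x ->
  poisson_prob x 0%N [set 0%N] = (expR (- x))%:E.
Proof.
move=> x0; rewrite /poisson_prob; case: ifPn => [xp|].
  by rewrite esum_set1 /poisson_pmf xp ?expr0 ?fact0 ?invr1 ?mulr1 ?mul1r// lee_fin expR_ge0.
rewrite -leNgt => x0'; have -> : x = 0 by apply/eqP; rewrite eq_le x0 x0'.
by rewrite diracE mem_set// oppr0 expR0.
Qed.

(** The inequality [1 - exp (-x) <= x] at the mean number of points. *)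
Lemma point_count_gt0_le d (O : measurableType d) (P : probability O R)
    (E : set R) (X : O -> set R) (Lam : set R -> \bar R) (B : set R) :
  poisson_point_process P E X Lam -> measurable B -> 0 <= fine (Lam B) ->
  (P [set w | (0 < Defs.count X B w)%N] <= (fine (Lam B))%:E)%E.
Proof.
move=> [_ mX law _] mB L0.
rewrite (_ : [set w | _] = ~` [set w | Defs.count X B w = 0%N]); last first.
  by apply/seteqP; split => w /=; rewrite lt0n => /eqP.
rewrite probability_setC; last first.
  have := mX _ mB measurableT [set 0%N]; rewrite setTI; exact.
rewrite law// poisson_prob0// -EFinB lee_fin.
by have := expR_ge1Dx (- fine (Lam B)); lra.
Qed.

End PoissonProb.

Section PointProcess.
Context {R : realType} {d : measure_display} {O : measurableType d}.
Variables (P : probability O R) (E : set R) (X : O -> set R).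
Variable Lam : set R -> \bar R.
Hypothesis X_poisson : poisson_point_process P E X Lam.

Lemma measurable_point_count (B : set R) (A : set nat) : measurable B ->
  measurable [set w | A (Defs.count X B w)].
Proof.
move=> mB; have [_ mX _ _] := X_poisson.
by have := mX _ mB measurableT A; rewrite setTI; exact.
Qed.

Lemma point_counts_independent (T : finType) (B : T -> set R) (A : T -> set nat) :
  (forall p, measurable (B p)) -> trivIset setT B ->
  P (\bigcap_(p in [set: T]) [set w | A p (Defs.count X (B p) w)]) =
  (\prod_(p : T) P [set w | A p (Defs.count X (B p) w)])%E.
Proof.
move=> mB tB; have [_ _ _ Xind] := X_poisson.
(* Independence is given for families indexed by ordinals; [enum_val] carries it to any finite index
   type. *)
have tB' : trivIset setT (fun i : 'I_#|T| => B (enum_val i)).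
  apply/trivIsetP => i j _ _ ij; move/trivIsetP : tB; apply => //.
  by apply: contra ij => /eqP/enum_val_inj ->.
have := Xind #|T| (fun i => B (enum_val i)) (fun i => mB _) tB' [set: 'I_#|T|]%SET
  (fun i => [set w | A (enum_val i) (Defs.count X (B (enum_val i)) w)]).
rewrite (_ : \bigcap_(i in _) _ =
    \bigcap_(p in [set: T]) [set w | A p (Defs.count X (B p) w)]).
  move=> ->.
    rewrite [RHS](big_enum_val (A := T)).
    by apply: eq_bigl => i; rewrite finset.in_setT.
  by move=> i _; exists (A (enum_val i)) => //; rewrite setTI.
apply/seteqP; split => w /=.
  by move=> h p _; have := h (enum_rank p); rewrite /= finset.in_setT enum_rankK; exact.
by move=> h i _; exact: h.
Qed.

Lemma point_counts_law (T : finType) (B : T -> set R) (v : T -> nat) :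
  (forall p, measurable (B p)) -> trivIset setT B ->
  P (\bigcap_(p in [set: T]) [set w | Defs.count X (B p) w = v p]) =
  (\prod_(p : T) poisson_prob (fine (Lam (B p))) 0%N [set v p])%E.
Proof.
move=> mB tB; rewrite (@point_counts_independent T B (fun p => [set v p]))//.
by have [_ _ law _] := X_poisson; apply: eq_bigr => p _; exact: law.
Qed.

Lemma two_points_le (B1 B2 : set R) : measurable B1 -> measurable B2 ->
  B1 `&` B2 = set0 -> 0 <= fine (Lam B1) -> 0 <= fine (Lam B2) ->
  (P [set w | (0 < Defs.count X B1 w)%N /\ (0 < Defs.count X B2 w)%N] <=
   (fine (Lam B1) * fine (Lam B2))%:E)%E.
Proof.
move=> m1 m2 B12 L1 L2.
have := @point_counts_independent bool (fun b => if b then B1 else B2)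
  (fun=> [set i | (0 < i)%N]).
rewrite (_ : \bigcap_(p in _) _ =
  [set w | (0 < Defs.count X B1 w)%N /\ (0 < Defs.count X B2 w)%N]); last first.
  apply/seteqP; split => w /=.
    by move=> h; split; [exact: (h true)|exact: (h false)].
  by move=> [h1 h2] [].
move=> ->; last 2 first.
- by case.
- by apply/trivIsetP => -[] [] //= _ _ _; rewrite // setIC.
rewrite big_bool /= EFinM; apply: lee_pmul => //.
- exact: (point_count_gt0_le X_poisson).
- exact: (point_count_gt0_le X_poisson).
Qed.

End PointProcess.

(** * Reflected node cells and negligibility of ties *)

Section NodeCells.
Context {R : realType}.
Variables (r tau : R).
Hypotheses (r0 : 0 < r) (tau0 : 0 <= tau) (taur : tau <= r).

Definition node_cell n (l j : nat) : set R :=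
  `[l%:R * r - grid tau n j, l%:R * r - grid tau n j.-1[%classic.

(** As [tau <= r], a cell with index [l] lies between [(l-1) r] and [l r], which determines [l];
    monotonicity of the grid then determines [j]. *)
Lemma node_cell_inj n l j l' j' x : node_cell n l j x -> node_cell n l' j' x ->
  l = l' /\ j = j'.
Proof.
rewrite /node_cell/= !in_itv/= => /andP[h1 h2] /andP[h3 h4].
have H1 := grid_le tau n j; have H2 := grid_le tau n j'.
have H3 := grid_ge0 n tau0 j.-1; have H4 := grid_ge0 n tau0 j'.-1.
have lt_l a b : a%:R * r - r <= x -> x < b%:R * r -> (a <= b)%N.
  move=> ax xb; rewrite leqNgt; apply/negP => ba.
  have : b.+1%:R * r <= a%:R * r by rewrite ler_pM2r// ler_nat.
  by rewrite -(natr1 b) mulrDl mul1r; lra.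
have ll' : l = l'.
  by apply/eqP; rewrite eqn_leq; apply/andP; split; apply: lt_l; have := taur; lra.
split => //; move: h3 h4; rewrite -ll' => h3 h4.
have lt_j a b : l%:R * r - grid tau n a <= x -> x < l%:R * r - grid tau n b.-1 ->
    (b <= a)%N.
  move=> ax xb; rewrite leqNgt; apply/negP => ab.
  have : grid tau n a <= grid tau n b.-1 by apply: grid_mono; rewrite -ltnS (ltn_predK ab).
  by lra.
by apply/eqP; rewrite eqn_leq; apply/andP; split; apply: lt_j.
Qed.

Lemma node_cell_trivIset m n K : trivIset setT
  (fun p : 'I_m * 'I_K => node_cell n (nat_of_ord p.1).+1 p.2).
Proof.
apply/trivIsetP => -[l j] [l' j'] _ _ /=; apply: contraNP => /eqP/set0P[x [h1 h2]].
have [/eqP ll' jj'] := node_cell_inj h1 h2.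
by apply/eqP; congr pair; apply: val_inj => //=; apply/eqP.
Qed.

Lemma node_cell_reflect n l j x : 0 < l%:R * r - x <= tau ->
  node_cell n l j x <-> cell n (l%:R * r - x) == j.
Proof.
move=> xt; rewrite (cell_gridE _ tau0)// /node_cell /= in_itv/=.
by split => /andP[? ?]; apply/andP; split; lra.
Qed.

Lemma node_cell_intensity k (lam : nat -> R -> R) l n j :
  (forall l : nat, (1 <= l <= k)%N -> forall s : R, 0 <= s <= r -> 0 <= lam l s) ->
  (forall l : nat, (1 <= l <= k)%N ->
    lebesgue_measure.-integrable `[0, r] (EFin \o lam l)) ->
  (0 < l <= k)%N ->
  node_intensity r k lam (node_cell n l j) =
  reflected_intensity r (lam l) `](grid tau n j.-1), (grid tau n j)]%classic.
Proof.
move=> l0 li lk; apply: node_intensity_cell => //; first exact: l0.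
- exact: li.
- exact: grid_ge0.
- by apply: grid_mono; exact: leq_pred.
- exact: le_trans (grid_le _ _ _) taur.
Qed.

End NodeCells.

Section NodeProcess.
Context {R : realType} (r : R) (k : nat) (lam : nat -> R -> R).
Context {d : measure_display} {O : measurableType d} (P : probability O R).
Variables (X : O -> set R) (tau : R).
Hypothesis r0 : 0 < r.
Hypothesis lam_ge0 : forall l : nat, (1 <= l <= k)%N ->
  forall s : R, 0 <= s <= r -> 0 <= lam l s.
Hypothesis lam_int : forall l : nat, (1 <= l <= k)%N ->
  lebesgue_measure.-integrable `[0, r] (EFin \o lam l).
Hypothesis X_poisson :
  poisson_point_process P `[0, k%:R * r] X (node_intensity r k lam).
Hypotheses (tau0 : 0 <= tau) (taur : tau <= r).

Let finX w : finite_set (X w).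
Proof. by have [fX _ _ _] := X_poisson; case: (fX w). Qed.

Lemma point_count_gt0 (B : set R) x w : X w x -> B x ->
  (0 < Defs.count X B w)%N.
Proof.
move=> Xx Bx; rewrite (point_count_seq (p := fun x => x \in B) (finX w)); last first.
  by move=> y _; split=> [/mem_set|/set_mem].
rewrite -has_count; apply/hasP; exists x; last exact: mem_set.
by rewrite in_fset_set// inE.
Qed.

Lemma end_negligible x : P.-negligible [set w | X w x].
Proof.
exists [set w | (0 < Defs.count X [set x] w)%N]; split.
- exact: (measurable_point_count X_poisson [set i | (0 < i)%N]).
- apply/eqP; rewrite eq_le measure_ge0 andbT.
  have := point_count_gt0_le X_poisson (measurable_set1 x).
  by rewrite node_intensity_set1 /=; apply.
- by move=> w /= Xx; exact: point_count_gt0 Xx erefl.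
Qed.

Let rho n l j := fine (reflected_intensity r (lam l)
  `](grid tau n j.-1), (grid tau n j)]%classic).

Let rho_ge0 n l j : (0 < l <= k)%N -> 0 <= rho n l j.
Proof.
move=> lk; apply: fine_ge0; apply: reflected_intensity_ge0.
exact: lam_ge0.
Qed.

Let rho_fin n l j : (0 < l <= k)%N -> reflected_intensity r (lam l)
  `](grid tau n j.-1), (grid tau n j)]%classic = (rho n l j)%:E.
Proof.
move=> lk; rewrite fineK// ge0_fin_numE.
  by apply: reflected_intensity_fin => //; [exact: lam_ge0|exact: lam_int].
by apply: reflected_intensity_ge0; exact: lam_ge0.
Qed.

(** A tie puts its two points in cells of the same index [j], whatever the mesh, so it is covered by
    every event [D n]; by independence the probability of [D n] is at most the sum over [j] of the
    products of the two masses. *)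
Lemma tie_negligible l : (0 < l)%N -> (l < k)%N ->
  P.-negligible [set w | exists x, [/\ in_cell r tau l x, X w x & X w (x + r)]].
Proof.
move=> l0 lk; have lk1 : (0 < l <= k)%N by rewrite l0 ltnW.
have mgt n i j :
    measurable [set w | (0 < Defs.count X (node_cell r tau n i j) w)%N].
  apply: (measurable_point_count X_poisson [set i | (0 < i)%N]).
  exact: measurable_itv.
pose F n j := [set w | (0 < Defs.count X (node_cell r tau n l j) w)%N /\
                      (0 < Defs.count X (node_cell r tau n l.+1 j) w)%N].
have mF n j : measurable (F n j) by apply: measurableI; exact: mgt.
pose D n := \big[setU/set0]_(j < (cell n tau).+1) F n j.
have mD n : measurable (D n) by apply: bigsetU_measurable => j _; exact: mF.
exists (\bigcap_n D n); split.
- exact: bigcapT_measurable.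
- pose C := fine (reflected_intensity r (lam l.+1) setT).
  have Cfin : reflected_intensity r (lam l.+1) setT = C%:E.
    rewrite fineK// ge0_fin_numE.
      by apply: reflected_intensity_fin => //; [exact: lam_ge0|exact: lam_int].
    by apply: reflected_intensity_ge0; exact: lam_ge0.
  have C0 : 0 <= C.
    by apply/fine_ge0/reflected_intensity_ge0; exact: lam_ge0.
  apply/eqP; rewrite eq_le measure_ge0 andbT; apply/lee_addgt0Pr => e e0.
  rewrite add0e.
  (* With this bound on each mass in cell [l], the total mass [C] of the next cell gives at most
     [e]; the 1 allows [C = 0]. *)
  have eC : 0 < e / (C + 1) by rewrite divr_gt0// ltr_wpDl.
  have [dl dl0 small] := reflected_intensity_small (lam_ge0 lk1) (lam_int lk1) eC.
  (* 2 rather than 1, to have a mesh strictly below [dl]. *)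
  have [M hM] := eventually_mul_ge 2 dl0.
  have Mdl : M.+1%:R^-1 < dl.
    rewrite -[ltLHS]mul1r ltr_pdivrMr//.
    by apply: lt_le_trans (hM M (leqnn M)); rewrite ltr1n.
  apply: (@le_trans _ _ (P (D M))).
    apply: le_measure; [|by rewrite inE; exact: mD|by move=> w; apply].
    by rewrite inE; exact: bigcapT_measurable.
  apply: le_trans (Boole_inequality P (fun j _ => mF M j)) _.
  apply: (@le_trans _ _ (\sum_(j < (cell M tau).+1)
      ((e / (C + 1))%:E * (rho M l.+1 j)%:E))%E).
    apply: lee_sum => j _.
    have dis : node_cell r tau M l j `&` node_cell r tau M l.+1 j = set0.
      rewrite -subset0 => x [/(node_cell_inj r0 tau0 taur) h /h[]].
      by move=> /n_Sn.
    have := two_points_le X_poisson (measurable_itv _) (measurable_itv _) dis.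
    rewrite !(@node_cell_intensity _ _ _ r0 tau0 taur k lam)//.
    rewrite -/(rho M l j) -/(rho M l.+1 j) !rho_ge0//.
    move=> /(_ isT isT)/le_trans; apply.
    rewrite EFinM lee_wpmul2r// ?lee_fin ?rho_ge0// -lee_fin -rho_fin//.
    apply: small => //; rewrite lebesgue_measure_itv /= lte_fin.
    case: ifPn => _; last by rewrite lte_fin.
    by rewrite -EFinB lte_fin; apply: le_lt_trans (grid_step tau M j) Mdl.
  rewrite -ge0_sume_distrr; last by move=> j _; rewrite lee_fin rho_ge0.
  apply: (@le_trans _ _ ((e / (C + 1))%:E * C%:E)%E).
    rewrite lee_wpmul2l// ?lee_fin ?(ltW eC)// -Cfin.
    have lk2 : (1 <= l.+1 <= k)%N by [].
    have tB : trivIset setT (fun j => `](grid tau M j.-1), (grid tau M j)]%classic).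
      apply/trivIsetP => i j _ _ ij; rewrite -subset0 => x [] /=.
      rewrite !in_itv/= => /andP[h1 h2] /andP[h3 h4].
      wlog : i j ij h1 h2 h3 h4 / (i < j)%N.
        move=> W; move: ij; rewrite neq_ltn => /orP[ij|ij].
          by apply: (W i j) => //; rewrite neq_ltn ij.
        by apply: (W j i) => //; rewrite neq_ltn ij.
      move=> ij'; have : grid tau M i <= grid tau M j.-1.
        by apply: grid_mono; rewrite -ltnS (ltn_predK ij').
      by lra.
    apply: le_trans (reflected_intensity_sum (lam_ge0 lk2) (lam_int lk2)
      (cell M tau).+1 (fun j => measurable_itv _) tB).
    by apply: lee_sum => j _; rewrite rho_fin.
  rewrite -EFinM lee_fin mulrAC ler_pdivrMr; last lra.
  by rewrite ler_wpM2l ?(ltW e0)// lerDl.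
- move=> w /= [x [xl Xx Xxr]] n _; rewrite /D -bigcup_mkord.
  have sx : 0 < l%:R * r - x <= tau.
    by move: xl; rewrite /in_cell => /andP[? ?]; apply/andP; split; lra.
  have sx1 : l.+1%:R * r - (x + r) = l%:R * r - x.
    by rewrite -(natr1 l) mulrDl mul1r; lra.
  exists (cell n (l%:R * r - x)) => /=.
    by rewrite ltnS le_cell//; case/andP: sx => // /ltW.
  split; first by apply: point_count_gt0 Xx _; apply/node_cell_reflect.
  apply: point_count_gt0 Xxr _; apply/node_cell_reflect => //.
    by rewrite sx1.
  by rewrite sx1.
Qed.

Let S w : seq R := fset_set (X w).

Let inS w x : x \in S w -> X w x.
Proof. by rewrite /S in_fset_set// inE. Qed.

Let Sge0 w : all (fun x => 0 <= x) (S w).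
Proof.
apply/allP => x /inS; have [/(_ w)[_ sub] _ _ _] := X_poisson.
by move/sub; rewrite /= in_itv/= => /andP[].
Qed.

Let Sle w : all (fun x => x <= k%:R * r) (S w).
Proof.
apply/allP => x /inS; have [/(_ w)[_ sub] _ _ _] := X_poisson.
by move/sub; rewrite /= in_itv/= => /andP[].
Qed.

Definition backward_points w l : seq R :=
  [seq backward r l x | x <- S w & in_cell r tau l x].

Lemma backward_points_itv w l : all (fun x => 0 < x <= tau) (backward_points w l).
Proof.
apply/allP => _ /mapP[x /[!mem_filter]/andP[xl _] ->].
by move: xl; rewrite /in_cell /backward => /andP[? ?]; apply/andP; split; lra.
Qed.

Lemma count_backward_points n l j w :
  count_mem j (map (cell n) (backward_points w l)) =
  Defs.count X (node_cell r tau n l j) w.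
Proof.
rewrite /backward_points -map_comp count_map count_filter.
apply/esym/point_count_seq => // x Xx /=.
have [xl|xl] := boolP (in_cell r tau l x).
  rewrite andbT; apply: node_cell_reflect => //.
  by move: xl; rewrite /in_cell => /andP[? ?]; apply/andP; split; lra.
rewrite andbF; split => //; rewrite /node_cell/= in_itv/= => /andP[h1 h2].
apply: contraNP xl => _; rewrite /in_cell.
have := grid_le tau n j; have := grid_ge0 n tau0 j.-1.
by move=> ? ?; apply/andP; split; lra.
Qed.

Let kr := k%:R * r.

(* Discretising the positions makes the number of k-hops a polynomial in the
   numbers of nodes in the cells. *)
Lemma measurable_khop_number t (A : set nat) : 0 <= t ->
  measurable ((fun w => count (is_khop r t) (words (fun=> S w) k.-1)) @^-1` A).
Proof.
move=> t0.
pose g n h :=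
  uniq h && path (connected_cells r n) (cell n (0 : R)) (rcons h (cell n t)).
have st w : exists M, forall n, (M <= n)%N ->
    count (g n) (words (fun=> map (cell n) (S w)) k.-1) =
    count (is_khop r t) (words (fun=> S w) k.-1).
  exact: khop_words_stable.
apply: (measurable_eventually_eq _ st) => n; pose K := (cell n kr).+1.
have -> : (fun w => count (g n) (words (fun=> map (cell n) (S w)) k.-1)) =
    (fun w => word_poly K (fun l j => count_mem j (map (cell n) (S w))) (g n) k.-1).
  apply/funext => w; apply: count_words_poly => l _; rewrite all_map.
  apply/allP => x xS /=; rewrite ltnS le_cell//.
    exact: (allP (Sge0 w)).
  exact: (allP (Sle w)).
apply: measurable_word_poly => p a.
pose B := [set x : R | p.2%:R - 1 < x * n.+1%:R <= p.2%:R].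
have mB : measurable B.
  have : measurable_fun setT (fun x : R => x * n.+1%:R) by exact: measurable_funM.
  move=> /(_ measurableT `](p.2%:R - 1), p.2%:R]%classic (measurable_itv _)).
  by rewrite setTI /B; congr measurable; apply/seteqP; split => x; rewrite /= in_itv.
have := measurable_point_count X_poisson [set a] mB.
congr measurable; apply/seteqP; split => w /=; rewrite count_map => <-.
  apply/esym/point_count_seq => // x Xx /=.
  rewrite cell_eq//; apply: (allP (Sge0 w)).
  by rewrite /S in_fset_set// inE.
apply/point_count_seq => // x Xx /=.
rewrite cell_eq//; apply: (allP (Sge0 w)).
by rewrite /S in_fset_set// inE.
Qed.

Lemma backward_words_stable w : exists M, forall n, (M <= n)%N ->
  word_poly (cell n tau).+1
    (fun l j => Defs.count X (node_cell r tau n l j) w) (sorted ltn) k.-1 =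
  count (sorted <%R) (words (backward_points w) k.-1).
Proof.
have [|M hM] := @sorted_words_stable R (backward_points w) k.-1.
  by move=> l _; apply: sub_all (backward_points_itv w l) => x /andP[/ltW].
exists M => n /hM <-; rewrite (@count_words_poly (cell n tau).+1).
  by apply: eq_word_poly => l j _ _; rewrite count_backward_points.
move=> l _; rewrite all_map; apply: sub_all (backward_points_itv w l) => x /=.
by move=> /andP[/ltW x0 xt]; rewrite ltnS le_cell.
Qed.

Lemma measurable_node_poly n A : measurable ((fun w => word_poly (cell n tau).+1
    (fun l j => Defs.count X (node_cell r tau n l j) w) (sorted ltn) k.-1) @^-1` A).
Proof.
apply: measurable_word_poly => p a.
by apply: (measurable_point_count X_poisson [set a]); exact: measurable_itv.
Qed.

(** Off the end points and the ties the deterministic equivalence [count_is_khop] applies. The range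
    of [l] is part of [F l], so that the union over all [l] only adds empty sets. *)
Lemma khop_number_ae : (1 < k)%N ->
  P.-negligible [set w | count (is_khop r (kr - tau)) (words (fun=> S w) k.-1) <>
                         count (sorted <%R) (words (backward_points w) k.-1)].
Proof.
move=> k1.
pose F l := [set w | (0 < l < k)%N /\ (X w (l%:R * r) \/
  exists x, [/\ in_cell r tau l x, X w x & X w (x + r)])].
apply: (@negligibleS _ _ _ _ (\bigcup_l F l)); last first.
  apply: negligible_bigcup => l; have [lk|lk] := boolP (0 < l < k)%N.
    have /andP[l0 lk'] := lk.
    apply: negligibleS (negligibleU (end_negligible (l%:R * r))
      (tie_negligible l0 lk')).
    by move=> w [_].
  by apply: negligibleS (negligible_set0 P) => w [h _]; rewrite h in lk.
move=> w /= neq; apply: contrapT => nF; apply: neq.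
have k0 : k = k.-1.+1 by rewrite prednK// ltnW.
rewrite /kr {1}k0; apply: (@count_is_khop R r tau k.-1 (S w)) => //.
- move=> l /andP[l0 lk]; apply/negP => /inS Xl; apply: nF; exists l => //.
  by split; [rewrite l0 k0|left].
- move=> l x /andP[l0 lk] xl /inS Xx; apply/negP => /inS Xxr; apply: nF.
  by exists l => //; split; [rewrite l0 k0 ltnS ltnW|right; exists x].
- by rewrite -ltnS -k0.
Qed.

End NodeProcess.

(** * The iterated integral as a random word count *)

Section ProcessIntegral.
Context {R : realType} {d : measure_display} {O : measurableType d}.
Variables (Q : probability O R) (m : nat) (N : nat -> O -> cumulative R R).
Variables (Lam : nat -> set R -> \bar R) (tau : R).
Hypothesis N_poisson : forall l, (0 < l <= m)%N -> poisson_process Q (N l) (Lam l).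
Hypothesis tau0 : 0 <= tau.

Let J w l : seq R := jumps (N l w) tau.

Let JP w l : (0 < l <= m)%N -> has_jumps (N l w) tau (J w l).
Proof. by move=> /N_poisson[N0 Nnat _ _ _]; exact: (jumpsP (N0 w) (Nnat w) tau0). Qed.

Let jump_count n w l j : nat := count_mem j (map (cell n) (J w l)).

(** [jumps] is obtained by choice, so its dependence on [w] is not known to be measurable; its
    counts per cell are increments of the path, and these are. *)
Lemma jump_countE n w l j : (0 < l <= m)%N ->
  (jump_count n w l j)%:R = N l w (grid tau n j) - N l w (grid tau n j.-1).
Proof.
move=> lm; rewrite (count_jumps_itv (JP w lm)).
- congr (_%:R); rewrite /jump_count count_map; apply: eq_in_count => x xJ /=.
  by apply: cell_gridE => //; exact: (allP (JP w lm).1).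
- exact: grid_ge0.
- by apply: grid_mono; exact: leq_pred.
- exact: grid_le.
Qed.

Let jump_countP n l j (a : nat) : (0 < l <= m)%N ->
  [set w | jump_count n w l j = a] =
  [set w | N l w (grid tau n j) - N l w (grid tau n j.-1) = a%:R].
Proof.
move=> lm; apply/seteqP; split => w /=; rewrite -jump_countE//; first by move->.
by move/eqP; rewrite eqr_nat => /eqP.
Qed.

Let measurable_jump_count n (l : 'I_m) j a :
  measurable [set w | jump_count n w l.+1 j = a].
Proof.
have lm : (0 < l.+1 <= m)%N by rewrite /= ltn_ord.
rewrite jump_countP//; have [_ _ mN _ _] := N_poisson lm.
have := measurable_funB (mN _ (grid_ge0 n tau0 j)) (mN _ (grid_ge0 n tau0 j.-1)).
by move=> /(_ measurableT [set a%:R] (measurable_set1 _)); rewrite setTI.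
Qed.

Definition jump_poly n w :=
  word_poly (cell n tau).+1 (jump_count n w) (sorted ltn) m.

Lemma measurable_jump_poly n A : measurable (jump_poly n @^-1` A).
Proof. by apply: measurable_word_poly => -[l j] a; exact: measurable_jump_count. Qed.

Definition jump_words w := count (sorted <%R) (words (J w) m).

Lemma jump_words_stable w :
  exists M, forall n, (M <= n)%N -> jump_poly n w = jump_words w.
Proof.
have J0 l : (0 < l <= m)%N -> all (fun x => 0 < x <= tau) (J w l).
  by move=> /(JP w)[].
have [|M hM] := @sorted_words_stable R (J w) m.
  by move=> l /J0; apply: sub_all => x /andP[/ltW].
exists M => n /hM; rewrite /jump_words => <-.
rewrite (@count_words_poly (cell n tau).+1)// => l /J0 Jl.
rewrite all_map; apply: sub_all Jl => x /=.
by move=> /andP[/ltW x0 xt]; rewrite ltnS le_cell.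
Qed.

Lemma iterated_integral_jump_words w : (0 < m)%N ->
  iterated_integral_closed (fun l => N l w) m.-1 tau = (jump_words w)%:R%:E.
Proof.
move=> m0; rewrite (@iterated_integral_closed_count _ _ _ (J w)) ?prednK//.
by move=> l /(JP w).
Qed.

Hypothesis N_indep :
  mutually_independent Q (fun l : 'I_m => sigma_of_process (N l.+1)).

Lemma jump_count_law n K (v : 'I_m * 'I_K -> nat) :
  Q (\bigcap_(p in [set: 'I_m * 'I_K])
       [set w | jump_count n w p.1.+1 p.2 = v p]) =
  (\prod_(p : 'I_m * 'I_K) poisson_prob
     (fine (Lam p.1.+1 `](grid tau n p.2.-1), (grid tau n p.2)]%classic))
     0%N [set v p])%E.
Proof.
rewrite -(poisson_family_law n v N_poisson N_indep tau0).
congr (Q _); apply: eq_bigcapr => -[l j] _ /=.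
by rewrite jump_countP//= ltn_ord.
Qed.

(** Stated for any array of counts [c] with the product law, so that it can be fed with the node
    counts. *)
Lemma jump_poly_law d2 (O2 : measurableType d2) (P : probability O2 R)
    (c : O2 -> nat -> nat -> nat) n A :
  (forall (p : 'I_m * 'I_(cell n tau).+1) a,
    measurable [set w | c w p.1.+1 p.2 = a]) ->
  (forall v : 'I_m * 'I_(cell n tau).+1 -> nat,
    P (\bigcap_(p in [set: 'I_m * 'I_(cell n tau).+1])
         [set w | c w p.1.+1 p.2 = v p]) =
    (\prod_(p : 'I_m * 'I_(cell n tau).+1) poisson_prob
     (fine (Lam p.1.+1 `](grid tau n p.2.-1), (grid tau n p.2)]%classic))
     0%N [set v p])%E) ->
  P ((fun w => word_poly (cell n tau).+1 (c w) (sorted ltn) m) @^-1` A) =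
  Q (jump_poly n @^-1` A).
Proof.
move=> mc law; apply: word_poly_law_eq => //.
by move=> v; rewrite law jump_count_law.
Qed.

End ProcessIntegral.

(** * The identity in law *)

Lemma measurable_natr_ereal (R : realType) d (O : measurableType d)
    (U : O -> \bar R) (u : O -> nat) : (forall w, U w = (u w)%:R%:E) ->
  (forall A, measurable (u @^-1` A)) -> measurable_fun setT U.
Proof.
move=> Uu mu _ B mB; rewrite setTI.
rewrite (_ : U @^-1` B = u @^-1` [set a | B a%:R%:E]); first exact: mu.
by apply/seteqP; split => w; rewrite /preimage/= Uu.
Qed.

Unset Implicit Arguments.

Theorem proposition3p1 (R : realType) (r : R) (r_gt0 : 0 < r)
  (k : nat) (k_ge2 : (2 <= k)%N)
  (lam : nat -> R -> R)
  (lam_ge0 : forall l : nat, (1 <= l <= k)%N ->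
    forall s : R, 0 <= s <= r -> 0 <= lam l s)
  (lam_int : forall l : nat, (1 <= l <= k)%N ->
    lebesgue_measure.-integrable `[0, r] (EFin \o lam l))
  (d : measure_display) (Omega : measurableType d) (P : probability Omega R)
  (X : Omega -> set R)
  (X_poisson : poisson_point_process P `[0, k%:R * r] X
    (node_intensity r k lam))
  (d' : measure_display) (Omega' : measurableType d')
  (Q : probability Omega' R)
  (N : nat -> Omega' -> cumulative R R)
  (N_poisson : forall l : nat, (1 <= l <= k.-1)%N ->
    poisson_process Q (N l) (reflected_intensity r (lam l)))
  (N_indep : mutually_independent Q
    (fun l : 'I_k.-1 => sigma_of_process (N l.+1)))
  (tau : R) (tau_ge0 : 0 <= tau) (tau_ler : tau <= r) :
  eq_in_distribution P Q
    (fun w => khop_count r (X w) k (k%:R * r - tau))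
    (fun w => iterated_integral_closed (fun l => N l w) k.-2 tau).
Proof.
set t := k%:R * r - tau.
have t0 : 0 <= t.
  have : 2%:R * r <= k%:R * r by rewrite ler_pM2r// ler_nat.
  by rewrite /t; lra.
have k0 : (0 < k.-1)%N by rewrite -ltnS prednK// ltnW.
have finX w : finite_set (X w) by have [/(_ w)[]] := X_poisson.
pose u w := count (is_khop r t) (words (fun=> fset_set (X w)) k.-1).
pose v w := count (sorted <%R) (words (backward_points r X tau w) k.-1).
pose u' w := jump_words k.-1 N tau w.
have Uu w : khop_count r (X w) k t = (u w)%:R%:E by exact: khop_count_words.
have Vu w : iterated_integral_closed (fun l => N l w) k.-2 tau = (u' w)%:R%:E.
  exact: (iterated_integral_jump_words N_poisson).
have mu A : measurable (u @^-1` A) by exact: (measurable_khop_number X_poisson).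
have v_stable := backward_words_stable X_poisson tau_ge0.
have mv_ n A := measurable_node_poly tau X_poisson n A.
have mv A : measurable (v @^-1` A).
  exact: (measurable_eventually_eq (fun n => mv_ n A) v_stable).
have u'_stable := jump_words_stable N_poisson tau_ge0.
have mu'_ n A : measurable (jump_poly k.-1 N tau n @^-1` A).
  exact: (measurable_jump_poly N_poisson).
have mu' A : measurable (u' @^-1` A).
  exact: (measurable_eventually_eq (fun n => mu'_ n A) u'_stable).
split.
- exact: (measurable_natr_ereal Uu mu).
- exact: (measurable_natr_ereal Vu mu').
move=> A mA; rewrite /pushforward.
pose A' := [set a : nat | A a%:R%:E].
rewrite (_ : _ @^-1` A = u @^-1` A'); last first.
  by apply/seteqP; split => w; rewrite /preimage/= Uu.
rewrite (_ : (fun w => iterated_integral_closed _ _ _) @^-1` A = u' @^-1` A'); last first.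
  by apply/seteqP; split => w; rewrite /preimage/= Vu.
have [Z [mZ Z0 Zuv]] := khop_number_ae r_gt0 lam_ge0 lam_int X_poisson tau_ge0 tau_ler k_ge2.
(* Off the null set [Z] the k-hops may be replaced by the increasing words of reflected nodes, both
   counts being measurable already. *)
rewrite (@probability_preimage_ae_eq _ _ _ _ P u v Z)//; last first.
  by move=> w nZ; apply: contrapT => uv; apply: nZ; exact: Zuv.
apply: (eventual_law_eq (fun n a => mv_ n [set a]) (fun n a => mu'_ n [set a])
  v_stable u'_stable) => n a.
apply: (jump_poly_law N_poisson tau_ge0 N_indep) => [p b|b].
  by apply: (measurable_point_count X_poisson [set b]); exact: measurable_itv.
(* The two product laws agree factor by factor: a node cell has the same mass as the time interval
   that it reflects. *)
rewrite (@point_counts_law _ _ _ _ _ _ _ X_poisson _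
  (fun p : 'I_k.-1 * 'I_(cell n tau).+1 => node_cell r tau n p.1.+1 p.2)).
- apply: eq_bigr => p _; congr (poisson_prob (fine _) _ _).
  apply: node_cell_intensity => //.
  by rewrite /= (leq_trans (ltn_ord p.1))// leq_pred.
- by move=> p; exact: measurable_itv.
- exact: node_cell_trivIset.
Qed.
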